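(* Let $R$ be an integer with $|R|\ge2$ and $B=\{0,b_1,b_2\}$ a three-element subset of $\mathbb{Z}$. Let $L\subset\mathbb{Z}$ be finite with $0\in L$ and $(\alpha_l)_{l\in L}$ nonzero complex numbers with $\alpha_0=1$. The matrix $\frac{1}{\sqrt3}\left(e^{2\pi i lc/R}\alpha_l\right)_{l\in L,c\in B}$ has orthonormal columns if and only if the following four conditions hold: (i) $R=3^\alpha r$ with $\alpha\in\mathbb{N}$ ($\alpha\ge1$) and $r$ not divisible by $3$; (ii) $b_i=3^\beta q_i$ ($i=1,2$) with $\beta\in\mathbb{N}\cup\{0\}$, $\beta\le\alpha-1$, $q_i$ not divisible by $3$, and $q_1\not\equiv q_2\pmod3$; (iii) every $l\in L\setminus\{0\}$ is of the form $l=3^{\alpha-1-\beta}s_l$ with $s_l$ not divisible by $3$ and $q_is_l$ divisible by $r$ for $i=1,2$; (iv) $\sum_{l\in L\setminus\{0\},\ s_l\equiv1\,(\mathrm{mod}\,3)}|\alpha_l|^2=1$ and $\sum_{l\in L\setminus\{0\},\ s_l\equiv2\,(\mathrm{mod}\,3)}|\alpha_l|^2=1$. If in addition (v) there exist $l_1,l_1',l_2,l_2'\in L\setminus\{0\}$ with $s_{l_1}\equiv s_{l_1'}\equiv1\pmod3$, $s_{l_2}\equiv s_{l_2'}\equiv2\pmod3$, $l_1\not\equiv l_1'\pmod R$ and $l_2\not\equiv l_2'\pmod R$, then $\left\{\Big(\prod_{j=0}^k\alpha_{l_j}\Big)e_{l_0+Rl_1+\dots+R^kl_k}: l_0\dots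 l_k\in\Omega(L)\right\}$ is a Parseval frame for $L^2(\mu(R,B))$.
   Context: $\mu(R,B)$ is the unique Borel probability measure on $\mathbb{R}$ with $\mu(E)=\frac13\sum_{c\in B}\mu(\tau_c^{-1}E)$, $\tau_c(x)=(x+c)/R$. $e_\lambda(x)=e^{2\pi i\lambda x}$. $\Omega(L)$: the empty word (giving $e_0$ with weight 1) and all words $l_0\dots l_k$ with $l_i\in L$, $l_k\ne0$. Parseval frame: $\sum_i|\langle v,f_i\rangle|^2=\|v\|^2$ for all $v$. *)

(* Defs.v *)
(* mathcomp-analysis (measure, integration, trigo) and
   real_closed's complex numbers R[i] over an abstract realType R. *)
From HB Require Import structures.
From mathcomp Require Import all_boot all_order all_algebra.
From mathcomp Require Import all_classical all_reals all_analysis.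
From mathcomp Require Import complex.
Set Implicit Arguments. Unset Strict Implicit. Unset Printing Implicit Defensive.
Import Order.TTheory GRing.Theory Num.Theory.
Local Open Scope classical_set_scope.
Local Open Scope ring_scope.
Local Open Scope complex_scope.

Section Defs.
Variable R : realType.

(* e^{i t} *)
Definition expi (t : R) : R[i] := cos t +i* sin t.

(* e_lambda(x) = e^{2 pi i lambda x} *)
Definition e_ (lam x : R) : R[i] := expi (2 * pi * lam * x).

(* squared modulus |z|^2 *)
Definition sqmod (z : R[i]) : R := complex.Re z ^+ 2 + complex.Im z ^+ 2.

(* integral over the whole line of a complex-valued function, computed
   componentwise: \int f dmu = \int Re f dmu + i \int Im f dmu *)
Definition cintegral (mu : {measure set R -> \bar R}) (f : R -> R[i]) : R[i] :=
  (Rintegral mu setT (fun x => complex.Re (f x))) +i* (Rintegral mu setT (fun x => complex.Im (f x))).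

(* <v, f> in L^2(mu) = \int v conj(f) dmu *)
Definition cinner (mu : {measure set R -> \bar R}) (v f : R -> R[i]) : R[i] :=
  cintegral mu (fun x => v x * (f x)^*).

(* v is (a representative of) an element of L^2(mu): measurable with
   square-integrable modulus *)
Definition L2fun (mu : {measure set R -> \bar R}) (v : R -> R[i]) : Prop :=
  measurable_fun setT (fun x => complex.Re (v x)) /\
  measurable_fun setT (fun x => complex.Im (v x)) /\
  mu.-integrable setT (fun x => (sqmod (v x))%:E).

(* Parseval frame property of a family (f_i)_{i in I} for L^2(mu) *)
Definition parseval_frame (I : choiceType) (mu : {measure set R -> \bar R})
  (J : set I) (f : I -> R -> R[i]) : Prop :=
  forall v, L2fun mu v ->
    (\esum_(i in J) (sqmod (cinner mu v (f i)))%:E = \int[mu]_x (sqmod (v x))%:E)%E.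

(* self-similarity: mu(E) = 1/3 sum_{c in B} mu(tau_c^{-1} E), tau_c x = (x+c)/Rn *)
Definition self_similar (mu : {measure set R -> \bar R}) (Rn : int) (B : seq int) : Prop :=
  forall E : set R, measurable E ->
    (mu E = ((3 : R)^-1)%:E *
           \sum_(c <- B) mu ((fun x : R => ((x + c%:~R) / Rn%:~R)%R) @^-1` E))%E.

(* entry (l, c) of the matrix (1/sqrt 3) (e^{2 pi i l c / Rn} alpha_l) *)
Definition mat_entry (Rn : int) (alpha : int -> R[i]) (l c : int) : R[i] :=
  ((Num.sqrt (3 : R))^-1)%:C * expi (2 * pi * (l * c)%:~R / Rn%:~R) * alpha l.

(* the columns (indexed by c in B) are orthonormal in C^L *)
Definition orthonormal_columns (Rn : int) (L B : seq int) (alpha : int -> R[i]) : Prop :=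
  forall c c', c \in B -> c' \in B ->
    \sum_(l <- L) mat_entry Rn alpha l c * (mat_entry Rn alpha l c')^* = (c == c')%:R.

(* Omega(L): empty word, and words l_0...l_k with l_i in L, l_k <> 0 *)
Definition Omega (L : seq int) : set (seq int) :=
  [set w | w = [::] \/ (all (fun l => l \in L) w /\ last 0 w != 0)].

(* frequency l_0 + Rn l_1 + ... + Rn^k l_k *)
Definition freq (Rn : int) (w : seq int) : int :=
  \sum_(j < size w) Rn ^+ j * nth 0 w j.

(* frame element (prod_j alpha_{l_j}) e_{freq w} *)
Definition frame_elt (Rn : int) (alpha : int -> R[i]) (w : seq int) : R -> R[i] :=
  fun x => (\prod_(l <- w) alpha l) * e_ (freq Rn w)%:~R x.

End Defs.

(* Conditions (i)-(iv), with explicit witnesses a (=alpha), r, beta, q1, q2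
   and s (l |-> s_l). *)
Definition conds_i_iv (R : realType) (Rn b1 b2 : int) (L : seq int)
  (alpha : int -> R[i]) (a : nat) (r : int) (beta : nat) (q1 q2 : int)
  (s : int -> int) : Prop :=
  [/\ (* (i) *) (1 <= a)%N /\ Rn = 3 ^+ a * r /\ ~~ (3 %| r)%Z,
      (* (ii) *) [/\ (beta <= a - 1)%N, b1 = 3 ^+ beta * q1, b2 = 3 ^+ beta * q2,
                  ~~ (3 %| q1)%Z /\ ~~ (3 %| q2)%Z & (q1 != q2 %[mod 3])%Z],
      (* (iii) *) (forall l, l \in L -> l != 0 ->
                  [/\ l = 3 ^+ (a - 1 - beta) * s l, ~~ (3 %| s l)%Z,
                      (r %| q1 * s l)%Z & (r %| q2 * s l)%Z]) &
      (* (iv) *) \sum_(l <- L | (l != 0) && ((s l %% 3)%Z == 1)) sqmod (alpha l) = 1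
               /\ \sum_(l <- L | (l != 0) && ((s l %% 3)%Z == 2)) sqmod (alpha l) = 1].

(* Condition (v) *)
Definition cond_v (Rn : int) (L : seq int) (s : int -> int) : Prop :=
  exists l1 l1' l2 l2',
    [/\ [/\ l1 \in L, l1' \in L, l2 \in L & l2' \in L],
        [/\ l1 != 0, l1' != 0, l2 != 0 & l2' != 0],
        [/\ (s l1 %% 3)%Z = 1, (s l1' %% 3)%Z = 1, (s l2 %% 3)%Z = 2 & (s l2' %% 3)%Z = 2] &
        (l1 != l1' %[mod Rn])%Z /\ (l2 != l2' %[mod Rn])%Z].

(* Main.v *)
Require Import Defs.
From HB Require Import structures.
From mathcomp Require Import all_boot all_order all_algebra.
From mathcomp Require Import all_classical all_reals all_analysis.
From mathcomp Require Import complex measurable_realfun.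
From mathcomp Require Import ring lra zify.
Import Order.TTheory GRing.Theory Num.Theory.
Import numFieldNormedType.Exports HBNNSimple.
Set Implicit Arguments. Unset Strict Implicit. Unset Printing Implicit Defensive.
Local Open Scope classical_set_scope.
Local Open Scope ring_scope.
Local Open Scope complex_scope.
(* Opened again so that [z^*] is [Num.conj] everywhere: under [complex_scope] it
   is [conjc] except below a ring operation. *)
Local Open Scope ring_scope.

(** Write [A_l v = 1/3 sum_c (v conj(e_l)) o tau_c] ([branch l v]). Self-similarity gives
    [<v, e_(l + R k)> = <A_l v, e_k>], and orthonormality of the columns gives
    [sum_l |alpha_l|^2 ||A_l v||^2 = ||v||^2]. So the defect
    [D_n v = ||v||^2 - sum |<v, f_w>|^2], summed over the words of length at most
    [n] ([defect n v]), satisfies [D_(n+1) v = sum_l |alpha_l|^2 D_n (A_l v)], hence is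
    nonnegative. On exponentials, [u t = lim_n D_n e_t] ([limdef t]) is a continuous function
    with [u 0 = 0] which at each [t] is the average of its values at the points
    [(t - l) / R], with weights [|alpha_l m((t - l) / R)|^2], [m] being the [mask]. At a positive
    maximum [t] of [u] on a large interval, all the successors of positive weight
    are again maxima; since [t / R^n -> 0], some [m (t / R^n)] vanishes, which
    makes [t] a rational with denominator dividing [3 b_1]. For a maximum with
    largest denominator, that denominator is prime to [R] and the successors are
    congruent modulo 1, so condition (v) leaves only the successor [t / R]; but
    then [t / R^n] is a maximum for all [n], contradicting [u 0 = 0]. Hence
    [D_n e_t -> 0] for all [t], and [D_n v -> 0] for all [v] in [L^2] since the
    exponentials span a dense subspace. *)

(** * Squared moduli, the character [ee], and cube roots of unity *)

Section ComplexExponential.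
Variable R : realType.
Implicit Types (x y t : R) (z w : R[i]).

Lemma conjCE (a b : R) : (a +i* b)^* = a -i* b.
Proof. by []. Qed.

Lemma conjC_real x : (x%:C)^* = x%:C.
Proof. exact: conjc_real. Qed.

Lemma sqmodE z : (sqmod z)%:C = z * z^*.
Proof.
case: z => a b; apply/eqP; rewrite conjCE eq_complex /sqmod /=.
by apply/andP; split; apply/eqP; ring.
Qed.

Lemma sqmodM z w : sqmod (z * w) = sqmod z * sqmod w.
Proof. by case: z w => [a b] [c d]; rewrite /sqmod /=; ring. Qed.

Lemma sqmod_conj z : sqmod z^* = sqmod z.
Proof. by case: z => a b; rewrite conjCE /sqmod /=; ring. Qed.

Lemma sqmod_ge0 z : 0 <= sqmod z.
Proof. by rewrite /sqmod addr_ge0 // sqr_ge0. Qed.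

Lemma sqmod_eq0 z : (sqmod z == 0) = (z == 0).
Proof.
case: z => a b; rewrite /sqmod eq_complex /= paddr_eq0 ?sqr_ge0 //.
by rewrite !sqrf_eq0.
Qed.

Lemma sqmod0 : sqmod (0 : R[i]) = 0.
Proof. by apply/eqP; rewrite sqmod_eq0. Qed.

Lemma sqmod1 : sqmod (1 : R[i]) = 1.
Proof. by rewrite /sqmod /=; ring. Qed.

Lemma sqmod_real x : sqmod (x%:C) = x ^+ 2.
Proof. by rewrite /sqmod /=; ring. Qed.

Definition ee x : R[i] := expi (2 * pi * x).

Lemma e_E t x : e_ t x = ee (t * x).
Proof. by rewrite /e_ /ee mulrA. Qed.

Lemma eeD x y : ee (x + y) = ee x * ee y.
Proof.
rewrite /ee /expi mulrDr cosD sinD; apply/eqP; rewrite eq_complex /=.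
by apply/andP; split; apply/eqP; ring.
Qed.

Lemma ee0 : ee 0 = 1.
Proof. by rewrite /ee mulr0 /expi cos0 sin0. Qed.

Lemma eeN x : ee (- x) = (ee x)^*.
Proof. by rewrite /ee mulrN /expi cosN sinN. Qed.

Lemma eeB x y : ee (x - y) = ee x * (ee y)^*.
Proof. by rewrite eeD eeN. Qed.

Lemma sqmod_ee x : sqmod (ee x) = 1.
Proof. by rewrite /sqmod /= cos2Dsin2. Qed.

Lemma ee_nat (n : nat) : ee n%:R = 1.
Proof.
elim: n => [|n IH]; first exact: ee0.
by rewrite -natr1 eeD IH mul1r /ee /expi mulr1 mulr_natl cos2pi sin2pi.
Qed.

Lemma ee_int (k : int) : ee k%:~R = 1.
Proof.
case: k => n; first exact: ee_nat.
by rewrite NegzE rmorphN /= eeN ee_nat conjC1.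
Qed.

(** Let [y] in [0, 1) be the fractional part. The real part of [ee y = ee (y / 2) ^ 2] is cos^2 -
    sin^2 at [pi * y], so its being 1 kills the sine; but the sine is positive on ]0, pi[, which
    leaves [y = 0]. *)
Lemma ee_eq1 x : ee x = 1 -> x \is a Num.int.
Proof.
move=> h1; have /andP[h2] := floor_itv x; rewrite rmorphD /= => h3.
set k := Num.floor x in h2 h3.
pose y := x - k%:~R.
have y0 : 0 <= y by rewrite subr_ge0.
have y1 : y < 1 by rewrite ltrBlDl.
have : ee y = 1 by rewrite /y eeB h1 ee_int rmorph1 mulr1.
have -> : ee y = ee (y / 2) * ee (y / 2) by rewrite -eeD -splitr.
move=> /(congr1 (@complex.Re R)) /=.
have -> : 2 * pi * (y / 2) = pi * y :> R by field.
have := cos2Dsin2 (pi * y) => hs hc.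
have s0 : sin (pi * y) = 0.
  by apply/eqP; rewrite -sqrf_eq0; apply/eqP; lra.
have [y_eq0|y_neq0] := eqVneq y 0.
  by rewrite -(subrK k%:~R x) -/y y_eq0 add0r intr_int.
have : 0 < sin (pi * y).
  have y_gt0 : 0 < y by rewrite lt_neqAle eq_sym y_neq0.
  by apply: sin_gt0_pi; rewrite mulr_gt0 ?pi_gt0 //= gtr_pMr ?pi_gt0.
by rewrite s0 ltxx.
Qed.

(** Three unit complex numbers with sum 0 and one of them equal to 1 are the cube roots of unity. So
    [3 x] and [3 y] are integers, not multiples of 3 because the roots differ from 1, and the
    product of the two nontrivial roots being 1 makes [x + y] an integer. *)
Lemma ee_sum0 x y : 1 + ee x + ee y = 0 ->
  exists k1 k2 : int, [/\ 3 * x = k1%:~R, 3 * y = k2%:~R,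
     ~~ (3 %| k1)%Z, ~~ (3 %| k2)%Z & (3 %| k1 + k2)%Z].
Proof.
have half u v : 1 + ee u + ee v = 0 -> 
   complex.Re (ee u) = - 2^-1 /\ exists k : int, 3 * u = k%:~R /\ ~~ (3 %| k)%Z.
  move=> h; have hu := sqmod_ee u; have hv := sqmod_ee v.
  move: h hu hv; case hu' : (ee u) => [a b]; case: (ee v) => c d /eqP.
  rewrite eq_complex /sqmod /= => /andP[/eqP h1 /eqP h2] hu hv.
  have ha : a = - 2^-1.
    have hc : c = - (1 + a) by lra.
    have hd : d = - b by lra.
    have : c ^+ 2 + d ^+ 2 = 1 + 2 * a + (a ^+ 2 + b ^+ 2) by rewrite hc hd; ring.
    by lra.
  split=> //.
  have /ee_eq1 /intrP[k hk] : ee (3 * u) = 1.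
    have -> : 3 * u = u + (u + u) by ring.
    rewrite !eeD hu'; apply/eqP; rewrite eq_complex /=.
    (* With [a = - 1/2], the cube of [a + i b] has real part [- 1/8 + 3/2 b^2] and imaginary part
       [3/4 b - b^3]; [b^2 = 3/4] turns these into 1 and 0. *)
    have hb : b ^+ 2 = 3 / 4 by move: hu; rewrite ha; nra.
    rewrite ha; apply/andP; split; apply/eqP; last first.
      by transitivity (b * (3 / 4) - b * b ^+ 2); [field | rewrite hb; ring].
    by transitivity (- 8^-1 + 3 / 2 * b ^+ 2); [field | rewrite hb; field].
  exists k; split => //; apply/negP => /dvdzP[j kj].
  have : u = j%:~R by move: hk; rewrite kj rmorphM /=; lra.
  move=> uj; move: hu'; rewrite uj ee_int => -[a1 _].
  by move: ha; rewrite -a1; lra.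
move=> h.
have [hx [k1 [hk1 dk1]]] := half _ _ h.
have [hy [k2 [hk2 dk2]]] := half y x (etrans (addrAC _ _ _) h).
exists k1, k2; split=> //.
have : ee (x + y) = 1.
  rewrite eeD; have hu := sqmod_ee x.
  move: h hu hx; case: (ee x) => a b; case: (ee y) => c d /= /eqP.
  rewrite eq_complex /sqmod /= => /andP[/eqP h1 /eqP h2] hu ha.
  have hc : c = a by lra.
  have hd : d = - b by lra.
  apply/eqP; rewrite eq_complex /= hc hd; apply/andP; split; apply/eqP; last ring.
  by rewrite -hu; ring.
move=> /ee_eq1 /intrP[j hj]; apply/dvdzP; exists j.
apply: (@intr_inj R); rewrite rmorphD rmorphM /= -hk1 -hk2 -hj; ring.
Qed.

(** For [w = ee (1/3)], [w^3 = 1] and [w <> 1] give [1 + w + w^2 = 0]. This equation has no real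
    solution, and its imaginary part [q (1 + 2 p) = 0] then fixes [p]. *)
Lemma ee_third : complex.Re (ee (3^-1 : R)) = - 2^-1 /\ complex.Im (ee (3^-1 : R)) != 0.
Proof.
have h3 : 1 + ee (3^-1) + ee (3^-1) * ee (3^-1) = 0 :> R[i].
  have h1 : ee 3^-1 - 1 != 0.
    rewrite subr_eq0; apply/eqP => /ee_eq1/intrP[k hk].
    have : ((3 * k)%:~R : R) = 1%:~R by rewrite rmorphM /= -hk mulfV ?pnatr_eq0.
    by move=> /intr_inj; lia.
  apply: (mulfI h1); rewrite mulr0.
  transitivity (ee 3^-1 * (ee (3^-1) * ee (3^-1)) - 1); first ring.
  rewrite -!eeD; have -> : 3^-1 + (3^-1 + 3^-1) = 1%:R :> R by field.
  by rewrite ee_nat subrr.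
have := sqmod_ee 3^-1; move: h3; case: (ee _) => p q /eqP.
rewrite eq_complex /sqmod /= => /andP[/eqP h1 /eqP h2] h.
have hp : p = - 2^-1.
  have hq : q * (1 + 2 * p) = 0 by rewrite -h2; ring.
  have : q != 0.
    apply/eqP => q0; move: h1 h; rewrite q0 => h1 h.
    have := sqr_ge0 (p + 2^-1).
    have -> : (p + 2^-1) ^+ 2 = - (3 / 4) + (1 + p + (p * p - 0 * 0)) by field.
    by rewrite h1; lra.
  by move: hq => /eqP; rewrite mulf_eq0 => /orP[->//|/eqP] hp _; lra.
split=> //; apply/eqP => q0; move: h; rewrite hp q0; lra.
Qed.

End ComplexExponential.

(** * Factoring out powers of 3: existence and uniqueness *)

Lemma ndvd3M (x y : int) : ~~ (3 %| x)%Z -> ~~ (3 %| y)%Z -> ~~ (3 %| x * y)%Z.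
Proof.
by move=> hx hy; rewrite dvdzE abszM Euclid_dvdM // negb_or -!dvdzE hx hy.
Qed.

Lemma pow3_mul_ndvd3 (x : int) : x != 0 ->
  exists n y, x = 3 ^+ n * y /\ ~~ (3 %| y)%Z.
Proof.
have [m] := ubnP `|x|%N; elim: m x => // m IH x xm x0.
have [/dvdzP[y xy]|h] := boolP (3 %| x)%Z; last by exists 0%N, x; rewrite mul1r.
have y0 : y != 0 by apply: contraNneq x0 => y0; rewrite xy y0 mul0r.
have [|n [z [yz hz]]] := IH y _ y0; first by move: xm x0; rewrite xy; lia.
by exists n.+1, z; split; rewrite // xy yz exprS; ring.
Qed.

Lemma pow3_mul_inj (m n : nat) (x y : int) : 3 ^+ m * x = 3 ^+ n * y ->
  ~~ (3 %| x)%Z -> ~~ (3 %| y)%Z -> m = n /\ x = y.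
Proof.
elim: m n => [|m IH] [|n] h hx hy.
- by move: h; rewrite !mul1r.
- move: hx; rewrite -[x]mul1r -[1]/(3 ^+ 0) h exprS -mulrA dvdz_mulr //.
- move: hy; rewrite -[y]mul1r -[1]/(3 ^+ 0) -h exprS -mulrA dvdz_mulr //.
- have [|-> ->] := IH n _ hx hy; last by [].
  by move: h; rewrite !exprS -!mulrA => /mulfI; apply.
Qed.

Lemma ndvd3_modz (x : int) : ~~ (3 %| x)%Z -> ((x %% 3)%Z != 1) = ((x %% 3)%Z == 2).
Proof. lia. Qed.

Definition class_weight (R : realType) (L : seq int) (alpha : int -> R[i])
    (s : int -> int) (i : int) : R :=
  \sum_(l <- L | (l != 0) && ((s l %% 3)%Z == i)) sqmod (alpha l).

(** * The Gram matrix of the columns under conditions (i) to (iii) *)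

Section GramMatrix.
Variables (R : realType) (Rn : int) (L : seq int) (alpha : int -> R[i]).
Hypothesis Rn0 : Rn != 0.

(** Three times the inner product of the columns [c] and [c'], which depends only on
    [d = c - c']. *)
Definition gram (d : int) : R[i] :=
  \sum_(l <- L) (sqmod (alpha l))%:C * ee ((l * d)%:~R / Rn%:~R).

Lemma mat_entryM (l c c' : int) :
  mat_entry Rn alpha l c * (mat_entry Rn alpha l c')^* =
  3^-1 * ((sqmod (alpha l))%:C * ee ((l * (c - c'))%:~R / Rn%:~R)).
Proof.
rewrite /mat_entry -!mulrA.
have eE (d : int) : expi (2 * (pi * ((l * d)%:~R / Rn%:~R))) = ee ((l * d)%:~R / Rn%:~R) :> R[i].
  by rewrite /ee mulrA.
rewrite !eE mulrBr [in RHS]rmorphB /= mulrBl eeB sqmodE.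
move: (ee _) (ee _) => u v; rewrite !rmorphM /= conjC_real.
have -> : 3^-1 = ((Num.sqrt 3)^-1)%:C * ((Num.sqrt 3)^-1)%:C :> R[i].
  by rewrite -rmorphM /= -invfM -expr2 sqr_sqrtr ?fmorphV ?rmorph_nat.
ring.
Qed.

Lemma orthonormal_columnsP (B : seq int) :
  orthonormal_columns Rn L B alpha <->
  forall c c', c \in B -> c' \in B -> gram (c - c') = 3 * (c == c')%:R.
Proof.
have h3 : (3 : R[i]) != 0 by rewrite pnatr_eq0.
split=> h c c' hc hc'; have := h c c' hc hc'.
  under eq_bigr do rewrite mat_entryM.
  by rewrite -mulr_sumr -/(gram _) => <-; rewrite mulVKf.
under [in X in _ -> X]eq_bigr do rewrite mat_entryM.
by rewrite -mulr_sumr -/(gram _) => ->; rewrite mulKf.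
Qed.

Section Classes.
Variables (a beta : nat) (r : int) (s : int -> int).
Hypothesis (uL : uniq L) (L0 : 0 \in L) (alpha0 : alpha 0 = 1).
Hypothesis (a1 : (1 <= a)%N) (RnE : Rn = 3 ^+ a * r) (r3 : ~~ (3 %| r)%Z)
  (beta_le : (beta <= a - 1)%N).
Hypothesis hs : forall l, l \in L -> l != 0 ->
  l = 3 ^+ (a - 1 - beta) * s l /\ ~~ (3 %| s l)%Z.

Local Notation wt := (class_weight L alpha s).

Lemma sum_classes (F : int -> R[i]) :
  \sum_(l <- L) (sqmod (alpha l))%:C * F l = F 0 +
   (\sum_(l <- L | (l != 0) && ((s l %% 3)%Z == 1)) (sqmod (alpha l))%:C * F l +
    \sum_(l <- L | (l != 0) && ((s l %% 3)%Z == 2)) (sqmod (alpha l))%:C * F l).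
Proof.
rewrite (bigD1_seq 0) //= alpha0 sqmod1 mul1r; congr (_ + _).
rewrite (bigID (fun l => (s l %% 3)%Z == 1)) /=; congr (_ + _).
rewrite big_seq_cond [RHS]big_seq_cond; apply: eq_bigl => l.
have [lL|//] := boolP (l \in L); have [//|l0 /=] := eqVneq l 0.
by rewrite ndvd3_modz //; have [] := hs lL l0.
Qed.

Lemma gram0 : gram 0 = 1 + (wt 1)%:C + (wt 2)%:C.
Proof.
rewrite /gram; under eq_bigr do rewrite mulr0 mul0r ee0.
rewrite (sum_classes (fun=> 1)) addrA /class_weight !rmorph_sum /=.
by under eq_bigr do rewrite mulr1; under [X in _ + X = _]eq_bigr do rewrite mulr1.
Qed.

(** The powers of 3 in [l] and [d] multiply to [3^(a-1)], one short of the power in [Rn], and [r]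
    cancels against [d' * s l]; hence [l d / Rn = k / 3]. *)
Lemma quotient_ee (l d d' : int) : l \in L -> l != 0 -> d = 3 ^+ beta * d' ->
  (r %| d' * s l)%Z ->
  exists2 k, k * r = d' * s l & ee ((l * d)%:~R / Rn%:~R) = ee (k%:~R / 3) :> R[i].
Proof.
move=> lL l0 dE /dvdzP[k hk]; exists k => //; congr ee.
have [lE _] := hs lL l0.
have R0 : (Rn%:~R : R) != 0 by rewrite intr_eq0.
apply: (mulIf R0); rewrite divfK //.
apply: (mulfI (_ : (3 : R) != 0)); first by rewrite pnatr_eq0.
have -> : 3 * (k%:~R / 3 * Rn%:~R) = (k * Rn)%:~R :> R by rewrite rmorphM /=; field.
have -> : 3 * (l * d)%:~R = (3 * (l * d))%:~R :> R by rewrite [RHS]rmorphM.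
congr (_%:~R); rewrite {1}lE dE RnE.
transitivity (3 ^+ (1 + (a - 1 - beta) + beta) * (d' * s l)); first by rewrite !exprD expr1; ring.
rewrite hk; have -> : (1 + (a - 1 - beta) + beta)%N = a by lia.
ring.
Qed.

(** The phase of the row [l] is a third of a turn in a direction depending only on [s l] mod 3; [e]
    is the representative in {1, -1} of [d' * r] mod 3. *)
Lemma gram_class (d d' : int) : d = 3 ^+ beta * d' -> ~~ (3 %| d')%Z ->
  (forall l, l \in L -> l != 0 -> (r %| d' * s l)%Z) ->
  exists e : int, (e = 1 \/ e = -1) /\
   gram d = 1 + (wt 1)%:C * ee (e%:~R / 3) + (wt 2)%:C * ee (- e%:~R / 3).
Proof.
move=> dE d3 hr.
pose e : int := if ((d' * r) %% 3)%Z == 1 then 1 else -1.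
exists e; split; first by rewrite /e; case: ifP; [left|right].
(* [sg] is 1 or -1, the residue 2 being represented by -1. *)
have key l (sg : int) : l \in L -> l != 0 -> (3 %| s l - sg)%Z ->
    ee ((l * d)%:~R / Rn%:~R) = ee ((sg * e)%:~R / 3) :> R[i].
  move=> lL l0 hsg; have [k hk ->] := quotient_ee lL l0 dE (hr l lL l0).
  suff /dvdzP[j hj] : (3 %| k - sg * e)%Z.
    have -> : k = j * 3 + sg * e by lia.
    rewrite rmorphD /= mulrDl eeD rmorphM /= mulfK ?ee_int ?mul1r // pnatr_eq0.
  have hke : (3 %| e - d' * r)%Z.
    by rewrite /e; have := ndvd3M d3 r3; case: ifP; lia.
  (* As [r^2] is 1 mod 3, [k] is congruent to [(k r) r = (d' r) (s l)], hence to [e * sg]. *)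
  have hkr : (3 %| 1 - r * r)%Z.
    have -> : 1 - r * r = - ((r - 1) * (r + 1)) by ring.
    rewrite rpredN; have [h|h] : (3 %| r - 1)%Z \/ (3 %| r + 1)%Z by move: r3; lia.
      by rewrite dvdz_mulr.
    by rewrite dvdz_mull.
  have -> : k - sg * e = k * (1 - r * r) + (r * (k * r - d' * s l)
             + (d' * r) * (s l - sg)) - sg * (e - d' * r) by ring.
  rewrite hk subrr mulr0 add0r.
  by rewrite rpredB ?rpredD ?dvdz_mull.
rewrite /gram sum_classes mul0r mul0r ee0 addrA; congr (_ + _ + _).
  rewrite /class_weight rmorph_sum /= mulr_suml big_seq_cond [RHS]big_seq_cond.
  apply: eq_bigr => l /and3P[lL l0 /eqP sl]; rewrite (key l 1) ?mul1r //; lia.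
rewrite /class_weight rmorph_sum /= mulr_suml big_seq_cond [RHS]big_seq_cond.
apply: eq_bigr => l /and3P[lL l0 /eqP sl].
by rewrite (key l (-1)) ?mulN1r ?rmorphN //; lia.
Qed.

(** The equation [1 + wt 1 * z + wt 2 * z^* = 0], with [z] nonreal of real part [- 1/2], gives
    [wt 1 = wt 2] on imaginary parts and then the common value 1 on real parts. *)
Lemma gram_class_eq0 (d d' : int) : d = 3 ^+ beta * d' -> ~~ (3 %| d')%Z ->
  (forall l, l \in L -> l != 0 -> (r %| d' * s l)%Z) ->
  gram d = 0 <-> wt 1 = 1 /\ wt 2 = 1.
Proof.
move=> dE d3 hr; have [e [he ->]] := gram_class dE d3 hr.
have [hp hq] := ee_third R.
have -> : ee (- e%:~R / 3) = (ee (e%:~R / 3 : R))^* by rewrite mulNr eeN.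
have [q [q0 ->]] : exists q : R, q != 0 /\ ee (e%:~R / 3 : R) = (- 2^-1) +i* q.
  case: he => ->.
    exists (complex.Im (ee (3^-1 : R))); split => //.
    by rewrite mul1r -hp; case: (ee _).
  exists (- complex.Im (ee (3^-1 : R))); rewrite oppr_eq0; split => //.
  rewrite (_ : (-1)%:~R / 3 = - 3^-1); last by rewrite rmorphN /= mulN1r.
  by rewrite eeN -hp; case: (ee _) => u v; rewrite conjCE.
rewrite conjCE; split => [/eqP|[-> ->]].
  rewrite eq_complex /= => /andP[/eqP h1 /eqP h2].
  have : q * (wt 1 - wt 2) = 0 by rewrite -h2; ring.
  move=> /eqP; rewrite mulf_eq0 (negbTE q0) /= subr_eq0 => /eqP h3.
  by move: h1; rewrite h3; lra.
by apply/eqP; rewrite eq_complex /=; apply/andP; split; apply/eqP; field.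
Qed.

End Classes.
End GramMatrix.

(** * Orthonormal columns are equivalent to conditions (i) to (iv) *)

Section Characterization.
Variables (R : realType) (Rn b1 b2 : int) (L : seq int) (alpha : int -> R[i]).
Hypotheses (Rn0 : Rn != 0) (uB : uniq [:: 0; b1; b2]) (uL : uniq L)
  (L0 : 0 \in L) (alphaN0 : forall l, l \in L -> alpha l != 0) (alpha0 : alpha 0 = 1).
Let B := [:: 0; b1; b2].

Lemma B_neq0 : [/\ b1 != 0, b2 != 0 & b1 != b2].
Proof.
by move: uB; rewrite /= !inE negb_or ![0 == _]eq_sym => /and3P[/andP[-> ->] ->].
Qed.

(* The Gram matrix entries add up to sum_l |alpha_l|^2 |sum_c e(l c / Rn)|^2 = 9,
   to which the row l = 0 alone contributes 9. *)
Lemma orthonormal_row_sum0 : orthonormal_columns Rn L B alpha ->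
  forall l, l \in L -> l != 0 ->
  1 + ee ((l * b1)%:~R / Rn%:~R) + ee ((l * b2)%:~R / Rn%:~R) = 0 :> R[i].
Proof.
move=> /orthonormal_columnsP hG.
pose z (l : int) : R[i] := \sum_(c <- B) ee ((l * c)%:~R / Rn%:~R).
have zE l : z l = 1 + ee ((l * b1)%:~R / Rn%:~R) + ee ((l * b2)%:~R / Rn%:~R).
  by rewrite /z !big_cons big_nil mulr0 mul0r ee0 addr0 addrA.
have sum9 : (\sum_(l <- L) sqmod (alpha l) * sqmod (z l))%:C = 9.
  rewrite rmorph_sum /=.
  transitivity (\sum_(c <- B) \sum_(c' <- B) gram Rn L alpha (c - c')).
    rewrite /gram; under [RHS]eq_bigr do rewrite exchange_big /=.
    rewrite exchange_big /=; apply: eq_bigr => l _.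
    rewrite rmorphM /= [X in _ * X = _]sqmodE {2}/z rmorph_sum /=.
    rewrite big_distrlr mulr_sumr /=; apply: eq_bigr => c _.
    rewrite mulr_sumr; apply: eq_bigr => c' _.
    by rewrite -eeB -mulrBl -rmorphB mulrBr.
  rewrite big_seq; under eq_bigr => c hc.
    rewrite big_seq; under eq_bigr => c' hc' do rewrite (hG c c' hc hc').
    rewrite -big_seq -mulr_sumr; over.
  rewrite -big_seq -mulr_sumr !big_cons !big_nil !eqxx ![0 == _]eq_sym [b2 == b1]eq_sym.
  have [/negbTE -> /negbTE -> /negbTE ->] := B_neq0.
  by rewrite /=; ring.
have z0 : z 0 = 3 by rewrite zE !mul0r ee0; ring.
move: sum9; rewrite (bigD1_seq 0) //= alpha0 sqmod1 z0 mul1r.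
have -> : sqmod (3 : R[i]) = 9 by rewrite -[3](rmorph_nat (real_complex R)) sqmod_real; ring.
rewrite rmorphD rmorph_nat /= -[X in _ = X]addr0 => /addrI /eqP.
rewrite eq_complex /= eqxx andbT psumr_eq0; last first.
  by move=> l _; rewrite mulr_ge0 ?sqmod_ge0.
move=> /allP h l lL l0; have := h l lL.
rewrite l0 /= mulf_eq0 !sqmod_eq0 (negbTE (alphaN0 lL)) /= => /eqP.
by rewrite zE.
Qed.

(** With the row 0 alone, [gram 0] would be 1 instead of 3. *)
Lemma orthonormal_exists_neq0 : orthonormal_columns Rn L B alpha ->
  exists2 l, l \in L & l != 0.
Proof.
move=> /orthonormal_columnsP/(_ 0 0); rewrite !inE eqxx subrr => /(_ isT isT) h.
have [/hasP//|/hasPn hL] := boolP (has (fun l => l != 0) L).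
move: h; rewrite /gram (bigD1_seq 0) //= alpha0 sqmod1 mul1r !mul0r ee0.
rewrite big1_seq => [|l /andP[l0 /hL]]; last by rewrite l0.
by move=> /eqP; rewrite addr0 mulr1 (eqr_nat _ 1 3).
Qed.

(** Every nonzero row sums to 0, so [3 l b_i = k_i Rn] with [k_i] prime to 3. Comparing powers of 3
    gives [a = 1 + v(l) + v(b_i)]: both [b_i] have the same valuation [beta], every nonzero [l] has
    valuation [a - 1 - beta], and the parts prime to 3 give the divisibility by [r]. Condition (iv)
    is then the orthogonality of the columns 0 and [b1]. *)
Lemma orthonormal_columns_conds : orthonormal_columns Rn L B alpha ->
  exists a r beta q1 q2 s, conds_i_iv Rn b1 b2 L alpha a r beta q1 q2 s.
Proof.
move=> hO; have hrow := orthonormal_row_sum0 hO.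
have [b10 b20 b12] := B_neq0.
have [a [r [RE r3]]] := pow3_mul_ndvd3 Rn0.
have [beta [q1 [b1E q13]]] := pow3_mul_ndvd3 b10.
have [beta' [q2 [b2E q23]]] := pow3_mul_ndvd3 b20.
have key l : l \in L -> l != 0 -> exists g y k1 k2,
    [/\ l = 3 ^+ g * y, ~~ (3 %| y)%Z,
        a = (1 + g + beta)%N /\ a = (1 + g + beta')%N,
        y * q1 = k1 * r /\ y * q2 = k2 * r &
        [/\ ~~ (3 %| k1)%Z, ~~ (3 %| k2)%Z & (3 %| k1 + k2)%Z]].
  move=> lL l0; have [g [y [lE y3]]] := pow3_mul_ndvd3 l0.
  have [k1 [k2 [h1 h2 k13 k23 k12]]] := ee_sum0 (hrow l lL l0).
  have R0 : (Rn%:~R : R) != 0 by rewrite intr_eq0.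
  have aux b k bb q : 3 * ((l * b)%:~R / Rn%:~R) = k%:~R :> R -> b = 3 ^+ bb * q ->
      ~~ (3 %| q)%Z -> ~~ (3 %| k)%Z -> a = (1 + g + bb)%N /\ y * q = k * r.
    move=> h bE q3 k3.
    have hZ : 3 * (l * b) = k * Rn.
      by apply: (@intr_inj R); rewrite !rmorphM /= -h rmorphM /=; field.
    have : 3 ^+ (1 + g + bb) * (y * q) = 3 ^+ a * (k * r).
      by rewrite [RHS]mulrCA -RE -hZ lE bE !exprD expr1; ring.
    by move=> /pow3_mul_inj[| | -> ->]; rewrite ?ndvd3M.
  have [ha1 hy1] := aux _ _ _ _ h1 b1E q13 k13.
  have [ha2 hy2] := aux _ _ _ _ h2 b2E q23 k23.
  by exists g, y, k1, k2.
have [l0 l0L l00] := orthonormal_exists_neq0 hO.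
have [g0 [y0 [k1 [k2 [l0E y03 [ha ha'] [hy1 hy2] [k13 k23 k12]]]]]] := key l0 l0L l00.
have bb : beta' = beta by lia.
pose s (l : int) := (l %/ 3 ^+ (a - 1 - beta))%Z.
have hs l : l \in L -> l != 0 -> [/\ l = 3 ^+ (a - 1 - beta) * s l, ~~ (3 %| s l)%Z,
                      (r %| q1 * s l)%Z & (r %| q2 * s l)%Z].
  move=> lL ln0; have [g [y [j1 [j2 [lE y3 [hg _] [hj1 hj2] _]]]]] := key l lL ln0.
  have hgE : (a - 1 - beta)%N = g by lia.
  have sE : s l = y by rewrite /s hgE lE mulKz // expf_neq0.
  rewrite sE hgE; split=> //.
    by apply/dvdzP; exists j1; rewrite -hj1 mulrC.
  by apply/dvdzP; exists j2; rewrite -hj2 mulrC.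
exists a, r, beta, q1, q2, s; split.
- by split; [lia | split].
- split; [lia | by [] | by rewrite -bb | by split |].
  apply/negP => /eqP hq.
  have /dvdzP[j hj] : (3 %| q1 - q2)%Z by rewrite -eqz_mod_dvd; apply/eqP.
  (* [k1] and [k2] are opposite and nonzero mod 3, so 3 does not divide [k1 - k2]; but
     [(k1 - k2) r = y0 (q1 - q2)]. *)
  have hk : ~~ (3 %| (k1 - k2) * r)%Z.
    by apply: ndvd3M => //; move: k13 k23 k12; lia.
  case/negP: hk; apply/dvdzP; exists (y0 * j).
  by rewrite mulrBl -hy1 -hy2 -mulrBr hj mulrA.
- exact: hs.
- have hG := (orthonormal_columnsP Rn L alpha B).1 hO.
  have b1B : b1 \in B by rewrite !inE eqxx orbT.
  have := hG b1 0 b1B (mem_head _ _).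
  rewrite subr0 (negbTE b10) mulr0.
  have hs2 l : l \in L -> l != 0 -> l = 3 ^+ (a - 1 - beta) * s l /\ ~~ (3 %| s l)%Z.
    by move=> lL ln0; have [] := hs l lL ln0.
  have a1 : (1 <= a)%N by lia.
  have bt : (beta <= a - 1)%N by lia.
  have hd l : l \in L -> l != 0 -> (r %| q1 * s l)%Z.
    by move=> lL ln0; have [] := hs l lL ln0.
  by move=> /(gram_class_eq0 Rn0 uL L0 alpha0 a1 RE r3 bt hs2 b1E q13 hd).
Qed.

(** Each difference of two digits is [3^beta * d'] with [d'] prime to 3, so that [gram_class_eq0]
    applies; for [b1 - b2] this is [q1 <> q2] mod 3. *)
Lemma conds_orthonormal_columns a r beta q1 q2 s :
  conds_i_iv Rn b1 b2 L alpha a r beta q1 q2 s -> orthonormal_columns Rn L B alpha.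
Proof.
case=> -[a1 [RE r3]] [bt b1E b2E [q13 q23] q12] hs hw.
have hs2 l : l \in L -> l != 0 -> l = 3 ^+ (a - 1 - beta) * s l /\ ~~ (3 %| s l)%Z.
  by move=> lL ln0; have [] := hs l lL ln0.
apply/orthonormal_columnsP.
have g0 : gram Rn L alpha 0 = 3.
  rewrite (gram0 Rn uL L0 alpha0 hs2) /class_weight hw.1 hw.2; apply/eqP.
  by rewrite eq_complex /= !addr0 eqxx andbT; apply/eqP; ring.
have gz d d' : d = 3 ^+ beta * d' -> ~~ (3 %| d')%Z ->
    (forall l, l \in L -> l != 0 -> (r %| d' * s l)%Z) -> gram Rn L alpha d = 0.
  by move=> dE d3 hd; apply/(gram_class_eq0 Rn0 uL L0 alpha0 a1 RE r3 bt hs2 dE d3 hd).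
have gN d d' : d = 3 ^+ beta * d' -> ~~ (3 %| d')%Z ->
    (forall l, l \in L -> l != 0 -> (r %| d' * s l)%Z) ->
    gram Rn L alpha d = 0 /\ gram Rn L alpha (- d) = 0.
  move=> dE d3 hd; split; first exact: gz dE d3 hd.
  by apply: (gz _ (- d')); rewrite ?dE ?mulrN ?rpredN // => l lL l0; rewrite mulNr rpredN hd.
have [g1 g1'] : gram Rn L alpha b1 = 0 /\ gram Rn L alpha (- b1) = 0.
  by apply: (gN _ q1) => // l lL l0; have [] := hs l lL l0.
have [g2 g2'] : gram Rn L alpha b2 = 0 /\ gram Rn L alpha (- b2) = 0.
  by apply: (gN _ q2) => // l lL l0; have [] := hs l lL l0.
have [g3 g3'] : gram Rn L alpha (b1 - b2) = 0 /\ gram Rn L alpha (- (b1 - b2)) = 0.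
  apply: (gN _ (q1 - q2)); first by rewrite b1E b2E mulrBr.
    by rewrite -eqz_mod_dvd.
  by move=> l lL l0; have [_ _ h1 h2] := hs l lL l0; rewrite mulrBl rpredB.
move: g3'; rewrite opprB => g3'.
have [b10 b20 b12] := B_neq0.
move=> c c'; rewrite !inE => /or3P[]/eqP -> /or3P[]/eqP ->;
  rewrite ?subrr ?sub0r ?subr0 ?eqxx ?g0 ?g1 ?g1' ?g2 ?g2' ?g3 ?g3' ?mulr1 //
   ?[0 == _]eq_sym ?[b2 == b1]eq_sym ?(negbTE b10) ?(negbTE b20) ?(negbTE b12) ?mulr0 //.
Qed.

End Characterization.

(** * Self-similarity for integrals instead of sets *)

Section SelfSimilarIntegral.
Variables (R : realType) (mu : probability R R).
Local Notation Rint f := (Rintegral mu setT f).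
Local Notation Rintg f := (mu.-integrable setT (EFin \o f)).

(** The right-hand side of the self-similarity relation has to be a genuine measure before equality
    on sets can be turned into equality of integrals. *)
Lemma sum_pushforward (I : eqType) (s : seq I) (tau : I -> R -> R) :
  (forall c, measurable_fun setT (tau c)) ->
  exists nu : {measure set R -> \bar R},
    (forall A, measurable A -> nu A = \sum_(c <- s) mu (tau c @^-1` A))%E /\
    (forall f : R -> \bar R, measurable_fun setT f -> (forall x, (0 <= f x)%E) ->
      \int[nu]_x f x = \sum_(c <- s) \int[mu]_x f (tau c x))%E.
Proof.
move=> mtau; elim: s => [|c s [nu [nuE nuI]]].
  exists mzero; split=> [A mA|f mf f0]; first by rewrite big_nil.
  by rewrite big_nil integral_measure_zero.
unshelve eexists (measure_add (pushforward mu (tau c)) nu); first exact: mtau.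
split=> [A mA|f mf f0].
  by rewrite big_cons -nuE //; exact: measure_addE.
by rewrite big_cons ge0_integral_measure_add // nuI // ge0_integral_pushforward //.
Qed.

Variables (Rn : int) (B : seq int).
Definition tau (c : int) (x : R) : R := (x + c%:~R) / Rn%:~R.
Hypothesis ss : self_similar mu Rn B.

Lemma measurable_tau c : measurable_fun setT (tau c).
Proof. by apply: measurable_funM => //; apply: measurable_funD. Qed.

Lemma ge0_self_similar_integral (f : R -> \bar R) : measurable_fun setT f ->
  (forall x, 0 <= f x)%E ->
  (\int[mu]_x f x = (3^-1 : R)%:E * \sum_(c <- B) \int[mu]_x f (tau c x))%E.
Proof.
move=> mf f0; have [nu [nuE nuI]] := sum_pushforward B measurable_tau.
have h3 : 0 <= (3^-1 : R) by rewrite invr_ge0.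
rewrite (@eq_measure_integral _ _ _ _ (mscale (NngNum h3) nu)).
  by rewrite ge0_integral_mscale // nuI.
move=> A mA _; rewrite ss //.
by transitivity ((3^-1 : R)%:E * nu A)%E; first rewrite nuE.
Qed.

(** The integral of [|f| o tau c] is one term of a sum of nonnegative integrals whose total is three
    times that of [|f|]. *)
Lemma integrable_tau (f : R -> R) c : c \in B -> Rintg f -> Rintg (f \o tau c).
Proof.
move=> cB /integrableP[/measurable_EFinP mf fi]; apply/integrableP; split.
  by apply/measurable_EFinP; apply: measurableT_comp => //; exact: measurable_tau.
move: fi; rewrite ge0_self_similar_integral //; last first.
  by apply/measurableT_comp => //; apply/measurable_EFinP.
rewrite (big_rem c) //= muleDr //; last first.
  by apply: ge0_adde_def; rewrite inE ?integral_ge0 // sume_ge0 // => *; rewrite integral_ge0.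
set X := (\int[mu]_x _)%E; set Y := (\sum_(_ <- _) _)%E => h.
have : ((3^-1 : R)%:E * X < +oo)%E.
  apply: le_lt_trans h; rewrite leeDl // mule_ge0 // ?lee_fin ?invr_ge0 //.
  by apply: sume_ge0 => *; rewrite integral_ge0.
have X0 : (0 <= X)%E by rewrite integral_ge0.
suff gen (Z : \bar R) : (0 <= Z -> (3^-1 : R)%:E * Z < +oo -> Z < +oo)%E by exact: gen.
case: Z => [z _ _ | _ | //]; first exact: ltry.
by rewrite mulry gtr0_sg ?invr_gt0 // mul1e ltxx.
Qed.

Lemma ge0_self_similar_Rintegral (f : R -> R) : Rintg f -> (forall x, 0 <= f x) ->
  Rint f = 3^-1 * \sum_(c <- B) Rint (f \o tau c).
Proof.
move=> fi f0; rewrite [LHS]/Rintegral ge0_self_similar_integral => [||x]; last 2 first.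
- by case/integrableP: fi.
- by rewrite lee_fin.
rewrite big_seq (eq_bigr (fun c => (Rint (f \o tau c))%:E)); last first.
  by move=> c cB; rewrite /Rintegral fineK // integrable_fin_num // integrable_tau.
by rewrite -big_seq sumEFin -EFinM.
Qed.

(** Write [f = |f| - (|f| - f)], a difference of nonnegative integrable functions. *)
Lemma self_similar_Rintegral (f : R -> R) : Rintg f ->
  Rint f = 3^-1 * \sum_(c <- B) Rint (f \o tau c).
Proof.
move=> fi.
have ai : Rintg (fun x => `|f x|).
  by apply: eq_integrable (integrable_abse fi).
have bi : Rintg (fun x => `|f x| - f x).
  by apply: eq_integrable (integrableB measurableT ai fi) => // x _; rewrite EFinB.
have b0 x : 0 <= `|f x| - f x by rewrite subr_ge0 ler_norm.
have -> : Rint f = Rint (fun x => `|f x|) - Rint (fun x => `|f x| - f x).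
  by rewrite -RintegralB //; apply: eq_Rintegral => x _; ring.
rewrite (ge0_self_similar_Rintegral ai) // (ge0_self_similar_Rintegral bi) //.
rewrite -mulrBr -sumrB; congr (_ * _); rewrite !big_seq; apply: eq_bigr => c cB.
rewrite -RintegralB //; first by apply: eq_Rintegral => x _ /=; ring.
- exact: integrable_tau ai.
- exact: integrable_tau bi.
Qed.

End SelfSimilarIntegral.

(** * Pointwise inequalities for squared moduli *)

Section SqmodInequalities.
Variable R : realType.
Implicit Types z w : R[i].

(** The weighted parallelogram law. Dropping the second square bounds [|z + w|^2] with a factor of
    [|z|^2] as close to 1 as desired; as an identity it passes to every quadratic form, in
    particular to the defect. *)
Lemma sqmod_parallelogram (a : R) z w : a != 0 ->
  sqmod (z + w) + sqmod (a%:C * z - (a^-1)%:C * w) =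
  (1 + a ^+ 2) * sqmod z + (1 + a ^- 2) * sqmod w.
Proof.
by case: z w => [x y] [x' y'] a0; rewrite /sqmod /=; field.
Qed.

Lemma sqmodD_le z w : sqmod (z + w) <= 2 * sqmod z + 2 * sqmod w.
Proof.
have := sqmod_parallelogram z w (oner_neq0 R).
rewrite expr1n invr1; have := sqmod_ge0 (1%:C * z - 1%:C * w); lra.
Qed.

Lemma normr_Re_le z : `|complex.Re z| <= 1 + sqmod z.
Proof.
case: z => a b; rewrite /sqmod /= ler_norml; apply/andP; split; have := sqr_ge0 b;
  have := sqr_ge0 (a + 2^-1); have := sqr_ge0 (a - 2^-1); rewrite !sqrrD ?sqrrN; nra.
Qed.

Lemma normr_Im_le z : `|complex.Im z| <= 1 + sqmod z.
Proof.
case: z => a b; have := normr_Re_le (b +i* a); rewrite /sqmod /=; lra.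
Qed.

End SqmodInequalities.

(** * Square-integrable complex functions on a probability space *)

Section L2.
Variables (R : realType) (mu : probability R R).
Implicit Types (u v : R -> R[i]).
Local Notation Rint f := (Rintegral mu setT f).
Local Notation Rintg f := (mu.-integrable setT (EFin \o f)).

Lemma RintgD (f g : R -> R) : Rintg f -> Rintg g -> Rintg (fun x => f x + g x).
Proof. by move=> hf hg; apply: eq_integrable (integrableD measurableT hf hg). Qed.

Lemma RintgZ (k : R) (f : R -> R) : Rintg f -> Rintg (fun x => k * f x).
Proof. by move=> hf; apply: eq_integrable (integrableZl measurableT k hf). Qed.

Lemma Rintg_cst (k : R) : Rintg (fun=> k).
Proof. exact: finite_measure_integrable_cst. Qed.

Lemma Rintg_le (f g : R -> R) : measurable_fun setT f ->
  (forall x, `|f x| <= g x) -> Rintg g -> Rintg f.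
Proof.
move=> mf fg; apply: le_integrable => //; first exact/measurable_EFinP.
by move=> x _; rewrite lee_fin (le_trans (fg x)) // ler_norm.
Qed.

Lemma Rintg_sum (I : Type) (s : seq I) (F : I -> R -> R) :
  (forall i, Rintg (F i)) -> Rintg (fun x => \sum_(i <- s) F i x).
Proof.
move=> h; elim: s => [|i s IH].
  by under eq_fun do rewrite big_nil; exact: Rintg_cst.
by under eq_fun do rewrite big_cons; exact: RintgD.
Qed.

Lemma Rint_sum (I : Type) (s : seq I) (F : I -> R -> R) :
  (forall i, Rintg (F i)) -> Rint (fun x => \sum_(i <- s) F i x) = \sum_(i <- s) Rint (F i).
Proof.
move=> h; elim: s => [|i s IH].
  under eq_Rintegral do rewrite big_nil.
  by rewrite big_nil Rintegral_cst // mul0r.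
under eq_Rintegral do rewrite big_cons.
by rewrite big_cons -IH RintegralD //; exact: Rintg_sum.
Qed.

Lemma Rint_cst (k : R) : Rint (fun=> k) = k.
Proof.
rewrite Rintegral_cst // (_ : fine _ = 1) ?mulr1 //.
by rewrite -[RHS]/(fine 1%:E); congr fine; exact: probability_setT.
Qed.

Definition cmeas v := measurable_fun setT (fun x => complex.Re (v x)) /\
  measurable_fun setT (fun x => complex.Im (v x)).

Lemma cmeas_cst (c : R[i]) : cmeas (fun=> c).
Proof. by split; exact: measurable_cst. Qed.

Lemma cmeas_real (f : R -> R) : measurable_fun setT f -> cmeas (fun x => (f x)%:C).
Proof. by split => //; exact: measurable_cst. Qed.

Lemma cmeasD u v : cmeas u -> cmeas v -> cmeas (fun x => u x + v x).
Proof.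
move=> [ur ui] [vr vi]; split.
  by under eq_fun do rewrite raddfD; exact: measurable_funD.
by under eq_fun do rewrite raddfD; exact: measurable_funD.
Qed.

Lemma cmeasM u v : cmeas u -> cmeas v -> cmeas (fun x => u x * v x).
Proof.
move=> [ur ui] [vr vi]; split.
  have -> : (fun x => complex.Re (u x * v x)) =
     (fun x => complex.Re (u x) * complex.Re (v x) - complex.Im (u x) * complex.Im (v x)).
    by apply/funext => x; case: (u x) (v x) => [a b] [c d].
  by apply: measurable_funB; exact: measurable_funM.
have -> : (fun x => complex.Im (u x * v x)) =
   (fun x => complex.Re (u x) * complex.Im (v x) + complex.Im (u x) * complex.Re (v x)).
  by apply/funext => x; case: (u x) (v x) => [a b] [c d].
by apply: measurable_funD; exact: measurable_funM.
Qed.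

Lemma cmeas_ee (t : R) : cmeas (fun x => ee (t * x)).
Proof.
have h : measurable_fun setT (fun x : R => 2 * pi * (t * x)).
  by apply: measurable_funM => //; apply: measurable_funM.
split.
  apply: (measurableT_comp (f := @cos R)) h.
  by apply: continuous_measurable_fun; exact: continuous_cos.
apply: (measurableT_comp (f := @sin R)) h.
by apply: continuous_measurable_fun; exact: continuous_sin.
Qed.

Lemma cmeas_comp v (f : R -> R) : cmeas v -> measurable_fun setT f -> cmeas (v \o f).
Proof.
move=> [vr vi] mf; split.
  exact: (measurableT_comp (f := fun x => complex.Re (v x))).
exact: (measurableT_comp (f := fun x => complex.Im (v x))).
Qed.

Lemma measurable_sqmod v : cmeas v -> measurable_fun setT (fun x => sqmod (v x)).
Proof.
by move=> [vr vi]; apply: measurable_funD; exact: measurable_funX.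
Qed.

Lemma L2fun_cmeas v : L2fun mu v -> cmeas v.
Proof. by move=> [? []]. Qed.

Lemma L2fun_integrable v : L2fun mu v -> Rintg (fun x => sqmod (v x)).
Proof. by move=> [? []]. Qed.

Lemma L2fun_dom v (g : R -> R) : cmeas v -> (forall x, sqmod (v x) <= g x) ->
  Rintg g -> L2fun mu v.
Proof.
move=> mv vg gi; split; first by case: mv.
split; first by case: mv.
apply: Rintg_le gi; first exact: measurable_sqmod.
by move=> x; rewrite ger0_norm ?sqmod_ge0.
Qed.

Lemma L2fun_bounded v (C : R) : cmeas v -> (forall x, sqmod (v x) <= C) -> L2fun mu v.
Proof. by move=> mv vC; apply: (L2fun_dom mv vC); exact: Rintg_cst. Qed.

Lemma L2funD u v : L2fun mu u -> L2fun mu v -> L2fun mu (fun x => u x + v x).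
Proof.
move=> hu hv; apply: (@L2fun_dom _ (fun x => 2 * sqmod (u x) + 2 * sqmod (v x))).
- by apply: cmeasD; exact: L2fun_cmeas.
- by move=> x; exact: sqmodD_le.
- by apply: RintgD; apply: RintgZ; exact: L2fun_integrable.
Qed.

Lemma L2funM_bounded u v (C : R) : L2fun mu u -> cmeas v ->
  (forall x, sqmod (v x) <= C) -> L2fun mu (fun x => u x * v x).
Proof.
move=> hu hv vC; apply: (@L2fun_dom _ (fun x => C * sqmod (u x))).
- by apply: cmeasM => //; exact: L2fun_cmeas.
- by move=> x; rewrite sqmodM mulrC ler_wpM2r ?sqmod_ge0.
- by apply: RintgZ; exact: L2fun_integrable.
Qed.

Lemma L2funZ (c : R[i]) v : L2fun mu v -> L2fun mu (fun x => c * v x).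
Proof.
move=> hv; have := L2funM_bounded hv (cmeas_cst c) (fun=> lexx _).
by under eq_fun do rewrite mulrC.
Qed.

Lemma L2fun_sum (I : Type) (s : seq I) (F : I -> R -> R[i]) :
  (forall i, L2fun mu (F i)) -> L2fun mu (fun x => \sum_(i <- s) F i x).
Proof.
move=> h; elim: s => [|i s IH].
  under eq_fun do rewrite big_nil.
  by apply: (@L2fun_bounded _ 0); [exact: cmeas_cst | rewrite sqmod0].
by under eq_fun do rewrite big_cons; exact: L2funD.
Qed.

Lemma L2fun_ee (t : R) : L2fun mu (fun x => ee (t * x)).
Proof. by apply: (L2fun_bounded (cmeas_ee t)) => x; rewrite sqmod_ee. Qed.

Lemma L2fun_mulee v (t : R) : L2fun mu v -> L2fun mu (fun x => v x * ee (t * x)).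
Proof.
by move=> hv; apply: (L2funM_bounded hv (cmeas_ee t)) => x; rewrite sqmod_ee.
Qed.

Lemma L2fun_Re v : L2fun mu v -> Rintg (fun x => complex.Re (v x)).
Proof.
move=> hv; apply: (@Rintg_le _ (fun x => 1 + sqmod (v x))).
- by case: hv.
- by move=> x; exact: normr_Re_le.
- by apply: RintgD; [exact: Rintg_cst | exact: L2fun_integrable].
Qed.

Lemma L2fun_Im v : L2fun mu v -> Rintg (fun x => complex.Im (v x)).
Proof.
move=> hv; apply: (@Rintg_le _ (fun x => 1 + sqmod (v x))).
- by case: hv => _ [].
- by move=> x; exact: normr_Im_le.
- by apply: RintgD; [exact: Rintg_cst | exact: L2fun_integrable].
Qed.

Lemma eq_cintegral u v : u =1 v -> cintegral mu u = cintegral mu v.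
Proof. by move=> /funext ->. Qed.

Lemma cintegralD u v : L2fun mu u -> L2fun mu v ->
  cintegral mu (fun x => u x + v x) = cintegral mu u + cintegral mu v.
Proof.
move=> hu hv; apply/eqP; rewrite eq_complex /=; apply/andP; split; apply/eqP.
  rewrite -RintegralD //; [|exact: L2fun_Re|exact: L2fun_Re].
  by apply: eq_Rintegral => x _; rewrite raddfD.
rewrite -RintegralD //; [|exact: L2fun_Im|exact: L2fun_Im].
by apply: eq_Rintegral => x _; rewrite raddfD.
Qed.

Lemma cintegralZ (c : R[i]) v : L2fun mu v ->
  cintegral mu (fun x => c * v x) = c * cintegral mu v.
Proof.
move=> hv; have rv := L2fun_Re hv; have iv := L2fun_Im hv; case: c => a b.
apply/eqP; rewrite eq_complex /=; apply/andP; split; apply/eqP.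
  rewrite -!RintegralZl // -RintegralB //; [|exact: RintgZ|exact: RintgZ].
  by apply: eq_Rintegral => x _; case: (v x).
rewrite -!RintegralZl // -RintegralD //; [|exact: RintgZ|exact: RintgZ].
by apply: eq_Rintegral => x _; case: (v x).
Qed.

Lemma cintegral_sum (I : Type) (s : seq I) (F : I -> R -> R[i]) :
  (forall i, L2fun mu (F i)) ->
  cintegral mu (fun x => \sum_(i <- s) F i x) = \sum_(i <- s) cintegral mu (F i).
Proof.
move=> h; elim: s => [|i s IH].
  rewrite big_nil /cintegral; under eq_Rintegral do rewrite big_nil.
  under [X in _ +i* X]eq_Rintegral do rewrite big_nil.
  by rewrite /= Rint_cst.
by rewrite big_cons -IH -cintegralD //; [apply: eq_cintegral => x; rewrite big_cons
  | exact: L2fun_sum].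
Qed.

Definition nrm2 v : R := Rint (fun x => sqmod (v x)).

Lemma eq_nrm2 u v : (forall x, sqmod (u x) = sqmod (v x)) -> nrm2 u = nrm2 v.
Proof. by move=> h; apply: eq_Rintegral => x _; rewrite h. Qed.

Lemma nrm2Z (c : R[i]) v : L2fun mu v -> nrm2 (fun x => c * v x) = sqmod c * nrm2 v.
Proof.
move=> hv; rewrite /nrm2 -RintegralZl //; last exact: L2fun_integrable.
by apply: eq_Rintegral => x _; rewrite sqmodM.
Qed.

Lemma nrm2_parallelogram (a : R) u v : a != 0 -> L2fun mu u -> L2fun mu v ->
  nrm2 (fun x => u x + v x) + nrm2 (fun x => a%:C * u x - (a^-1)%:C * v x) =
  (1 + a ^+ 2) * nrm2 u + (1 + a ^- 2) * nrm2 v.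
Proof.
move=> a0 hu hv.
have hu' := L2fun_integrable hu; have hv' := L2fun_integrable hv.
rewrite /nrm2 -!RintegralZl // -!RintegralD //; try exact: RintgZ.
- by apply: eq_Rintegral => x _; rewrite sqmod_parallelogram.
- exact/L2fun_integrable/L2funD.
- have := L2funD (L2funZ a%:C hu) (L2funZ (- (a^-1)%:C) hv).
  by under eq_fun do rewrite mulNr; exact: L2fun_integrable.
Qed.

(** The variance of [f] under the probability [mu] is nonnegative. *)
Lemma Rint_sqr_le (f : R -> R) : Rintg f -> Rintg (fun x => f x ^+ 2) ->
  (Rint f) ^+ 2 <= Rint (fun x => f x ^+ 2).
Proof.
move=> fi f2i; set m := Rint f.
have : 0 <= Rint (fun x => f x ^+ 2 + (- 2 * m * f x + m ^+ 2)).
  apply: Rintegral_ge0 => x _.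
  by rewrite (_ : _ + _ = (f x - m) ^+ 2) ?sqr_ge0 //; ring.
have mi := RintgZ (- 2 * m) fi; have ci := Rintg_cst (m ^+ 2).
rewrite RintegralD //; last exact: RintgD.
rewrite RintegralD // RintegralZl // Rint_cst -/m; lra.
Qed.

Lemma sqmod_cintegral_le v : L2fun mu v -> sqmod (cintegral mu v) <= nrm2 v.
Proof.
move=> hv; have rv := L2fun_Re hv; have iv := L2fun_Im hv.
have hv' := L2fun_integrable hv; have [mr mi] := L2fun_cmeas hv.
have r2 : Rintg (fun x => complex.Re (v x) ^+ 2).
  apply: Rintg_le hv'; first exact: measurable_funX.
  by move=> x; rewrite ger0_norm ?sqr_ge0 // /sqmod lerDl sqr_ge0.
have i2 : Rintg (fun x => complex.Im (v x) ^+ 2).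
  apply: Rintg_le hv'; first exact: measurable_funX.
  by move=> x; rewrite ger0_norm ?sqr_ge0 // /sqmod lerDr sqr_ge0.
by rewrite /nrm2 /sqmod RintegralD //= lerD // Rint_sqr_le.
Qed.

End L2.

Lemma ler_sum_uniq_subset (R : realType) (T : eqType) (s s' : seq T) (F : T -> R) :
  uniq s -> uniq s' -> {subset s <= s'} -> (forall x, 0 <= F x) ->
  \sum_(x <- s) F x <= \sum_(x <- s') F x.
Proof.
move=> us us' ss' F0; rewrite [leRHS](bigID (fun x => x \in s)) /= -[X in _ <= X + _]big_filter.
rewrite [X in _ <= X + _](perm_big s); first by rewrite lerDl sumr_ge0.
apply: uniq_perm => //; first exact: filter_uniq.
by move=> x; rewrite mem_filter; have [/ss' ->|] := boolP (x \in s).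
Qed.

(** * Words of bounded length and their recursive enumeration *)

Section Words.
Variables (R : realType) (Rn : int) (L : seq int) (alpha : int -> R[i]).
Hypotheses (uL : uniq L) (L0 : 0 \in L) (alpha0 : alpha 0 = 1).

(* Words of Omega do not end in 0, so prefixing 0 to the empty word gives back the
   empty word; this changes neither the weight (alpha_0 = 1) nor the frequency. *)
Definition wcons (l : int) (w : seq int) : seq int :=
  if (l == 0) && (w == [::]) then [::] else l :: w.

Fixpoint Omega_le (n : nat) : seq (seq int) :=
  if n is n'.+1 then [seq wcons l w | l <- L, w <- Omega_le n'] else [:: [::]].

Lemma mem_Omega_le n w : (w \in Omega_le n) =
  ((w == [::]) || (all (fun l => l \in L) w && (last 0 w != 0))) && (size w <= n)%N.
Proof.
elim: n w => [|n IH] w.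
  by rewrite inE leqn0 size_eq0; case: eqP => [->|] //=; rewrite andbF.
apply/allpairsP/idP => [[[l w'] /= [lL]]|].
  rewrite IH => /andP[h sw] ->; rewrite /wcons.
  have [//|hlw] := boolP ((l == 0) && (w' == [::])).
  rewrite /= lL ltnS sw andbT; case: (w') h hlw => [|l' w''] /= h; last by [].
  by rewrite andbT.
case: w => [_|l w] /=.
  exists (0, [::]); rewrite /= IH eqxx /wcons eqxx /=; split => //.
rewrite ltnS => /andP[/andP[/andP[lL aL] lw] sw].
exists (l, w); rewrite /= IH sw andbT aL /wcons; split => //.
  by case: (w) lw.
by case: (w) lw => [/negbTE -> //|l' w' _] /=; rewrite andbF.
Qed.

(** [wcons] is injective on pairs, since only [(0, [::])] yields the empty word; so sums over
    [Omega_le n] count each word once. *)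
Lemma uniq_Omega_le n : uniq (Omega_le n).
Proof.
elim: n => //= n IH; apply: allpairs_uniq => //.
move=> [l w] [l' w'] _ _ /=; rewrite /wcons.
by case: ifP => [/andP[/eqP -> /eqP ->]|_]; case: ifP => [/andP[/eqP -> /eqP ->]|_] // [-> ->].
Qed.

Lemma Omega_leP n w : w \in Omega_le n -> Omega L w.
Proof.
rewrite mem_Omega_le => /andP[/orP[/eqP ->|/andP[h1 h2]] _]; first by left.
by right.
Qed.

Lemma Omega_le_size w : Omega L w -> w \in Omega_le (size w).
Proof.
rewrite mem_Omega_le leqnn andbT => -[->//|[-> ->]]; by rewrite orbT.
Qed.

Lemma prod_wcons l w : \prod_(i <- wcons l w) alpha i = alpha l * \prod_(i <- w) alpha i.
Proof.
rewrite /wcons; case: ifP => [/andP[/eqP -> /eqP ->]|_]; last by rewrite big_cons.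
by rewrite !big_nil alpha0 mul1r.
Qed.

Lemma freq_wcons l w : freq Rn (wcons l w) = l + Rn * freq Rn w.
Proof.
rewrite /wcons /freq; case: ifP => [/andP[/eqP -> /eqP ->]|_].
  by rewrite !big_ord0 mulr0.
rewrite big_ord_recl /= expr0 mul1r mulr_sumr; congr (_ + _).
by apply: eq_bigr => i _; rewrite /bump /= add0n exprS mulrA.
Qed.

End Words.

(** * Branches of a function and the recursion for the defect *)

Section FrameDefect.
Variables (R : realType) (mu : probability R R) (Rn : int) (B L : seq int)
  (alpha : int -> R[i]).
Hypotheses (Rn0 : Rn != 0) (uB : uniq B) (uL : uniq L) (L0 : 0 \in L)
  (alpha0 : alpha 0 = 1) (ss : self_similar mu Rn B).
Hypothesis gramE :
  forall c c', c \in B -> c' \in B -> gram Rn L alpha (c - c') = 3 * (c == c')%:R.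
Implicit Types (u v : R -> R[i]).

Local Notation tau := (@tau R Rn).
Local Notation nrm2 := (nrm2 mu).

Let Rn0' : (Rn%:~R : R) != 0.
Proof. by rewrite intr_eq0. Qed.

Lemma L2fun_tau v c : c \in B -> L2fun mu v -> L2fun mu (v \o tau c).
Proof.
move=> cB hv; have mv := cmeas_comp (L2fun_cmeas hv) (measurable_tau Rn c).
split; first by case: mv.
split; first by case: mv.
exact: (integrable_tau ss cB (L2fun_integrable hv)).
Qed.

Lemma self_similar_cintegral v : L2fun mu v ->
  cintegral mu v = 3^-1 * \sum_(c <- B) cintegral mu (v \o tau c).
Proof.
move=> hv; rewrite {1}/cintegral.
rewrite (self_similar_Rintegral ss (L2fun_Re hv)) (self_similar_Rintegral ss (L2fun_Im hv)).
have -> : 3^-1 = (3^-1)%:C :> R[i] by rewrite fmorphV rmorph_nat.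
elim: (B) => [|c s IH]; first by rewrite !big_nil !mulr0.
rewrite !big_cons !mulrDr -IH; apply/eqP; rewrite eq_complex /=.
by apply/andP; split; apply/eqP; ring.
Qed.

Definition coef v (k : int) : R[i] := cintegral mu (fun x => v x * ee (- k%:~R * x)).

Lemma sqmod_cinner_frame_elt v w : L2fun mu v ->
  sqmod (cinner mu v (frame_elt Rn alpha w)) =
  sqmod (\prod_(l <- w) alpha l) * sqmod (coef v (freq Rn w)).
Proof.
move=> hv; rewrite /cinner /frame_elt -[X in _ = X * _]sqmod_conj -sqmodM; congr sqmod.
rewrite -cintegralZ; last exact: L2fun_mulee.
by apply: eq_cintegral => x; rewrite rmorphM /= e_E mulNr eeN; ring.
Qed.

Definition branch (l : int) v (x : R) : R[i] :=
  3^-1 * \sum_(c <- B) v (tau c x) * ee (- l%:~R * tau c x).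

Lemma L2fun_branch_term l v c : c \in B -> L2fun mu v ->
  L2fun mu (fun x => v (tau c x) * ee (- l%:~R * tau c x)).
Proof. by move=> cB hv; exact: (L2fun_tau cB (L2fun_mulee _ hv)). Qed.

Lemma L2fun_branch l v : L2fun mu v -> L2fun mu (branch l v).
Proof.
move=> hv; apply: L2funZ.
(* [L2fun_sum] asks for every summand to be in L^2, while composition with [tau c] is controlled
   only for [c] in [B]; other values of [c] are replaced by 0. *)
have -> : (fun x => \sum_(c <- B) v (tau c x) * ee (- l%:~R * tau c x)) =
  (fun x => \sum_(c <- B) (if c \in B then v (tau c x) * ee (- l%:~R * tau c x) else 0)).
  by apply/funext => x; rewrite big_seq [RHS]big_seq; apply: eq_bigr => c ->.
apply: L2fun_sum => c; have [cB|cB] := boolP (c \in B); first exact: L2fun_branch_term.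
by apply: (@L2fun_bounded _ _ _ 0) => [|x]; rewrite ?sqmod0 //; exact: cmeas_cst.
Qed.

(** Under [tau c] the phase [(l + Rn k) tau_c x] splits as [l tau_c x + k x + k c], and the integer
    [k c] disappears in the exponential. *)
Lemma coef_branch l v k : L2fun mu v -> coef v (l + Rn * k) = coef (branch l v) k.
Proof.
move=> hv; rewrite {1}/coef self_similar_cintegral; last exact: L2fun_mulee.
have E : coef (branch l v) k = 3^-1 * cintegral mu (fun x => \sum_(c <- B)
    (if c \in B then v (tau c x) * ee (- l%:~R * tau c x) * ee (- k%:~R * x) else 0)).
  rewrite -cintegralZ.
    apply: eq_cintegral => x; rewrite /branch -mulrA; congr (_ * _).
    by rewrite mulr_suml big_seq [RHS]big_seq; apply: eq_bigr => c ->.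
  apply: L2fun_sum => c; have [cB|cB] := boolP (c \in B); first exact/L2fun_mulee/L2fun_branch_term.
  by apply: (@L2fun_bounded _ _ _ 0) => [|x]; rewrite ?sqmod0 //; exact: cmeas_cst.
rewrite E cintegral_sum; last first.
  move=> c; have [cB|cB] := boolP (c \in B); first exact/L2fun_mulee/L2fun_branch_term.
  by apply: (@L2fun_bounded _ _ _ 0) => [|x]; rewrite ?sqmod0 //; exact: cmeas_cst.
congr (_ * _); rewrite big_seq [RHS]big_seq; apply: eq_bigr => c ->.
apply: eq_cintegral => x /=; rewrite -mulrA -eeD; congr (_ * _).
rewrite (_ : - (l + Rn * k)%:~R * tau c x =
   - l%:~R * tau c x + - k%:~R * x + (- (k * c))%:~R).
  by rewrite [LHS]eeD ee_int mulr1.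
by rewrite /tau rmorphD rmorphN !rmorphM /=; field.
Qed.

(** Expanding the squares produces [gram (c' - c)], which is 3 on the diagonal and 0 elsewhere;
    together with the factor 1/9 this leaves 1/3. *)
Lemma sum_sqmod_branch v x :
  \sum_(l <- L) sqmod (alpha l) * sqmod (branch l v x) =
  3^-1 * \sum_(c <- B) sqmod (v (tau c x)).
Proof.
pose y c := v (tau c x).
have bE l : sqmod (branch l v x) = 9^-1 *
    sqmod (\sum_(c <- B) y c * ee (- ((l * c)%:~R / Rn%:~R))).
  rewrite /branch sqmodM; congr (_ * _).
    by rewrite (_ : 3^-1 = (3^-1)%:C) ?sqmod_real ?fmorphV ?rmorph_nat //; field.
  (* The phase [- l x / Rn] is common to all digits and has modulus 1, so only [l c / Rn]
     matters. *)
  transitivity (sqmod (ee (- l%:~R * x / Rn%:~R)) *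
      sqmod (\sum_(c <- B) y c * ee (- ((l * c)%:~R / Rn%:~R)))); last first.
    by rewrite sqmod_ee mul1r.
  rewrite -sqmodM; congr sqmod.
  rewrite mulr_sumr; apply: eq_bigr => c _; rewrite [RHS]mulrCA -eeD; congr (_ * ee _).
  by rewrite /tau rmorphM /=; field.
apply: (@complexI R); rewrite rmorph_sum rmorphM rmorph_sum /=.
transitivity ((9^-1)%:C * \sum_(l <- L) \sum_(c <- B) \sum_(c' <- B)
    (y c * (y c')^*) * ((sqmod (alpha l))%:C * ee ((l * (c' - c))%:~R / Rn%:~R))).
  rewrite mulr_sumr; apply: eq_bigr => l _; rewrite bE !rmorphM /= [X in _ * (_ * X)]sqmodE.
  rewrite mulrCA; congr (_ * _); rewrite rmorph_sum /= big_distrlr /= mulr_sumr.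
  apply: eq_bigr => c _; rewrite mulr_sumr; apply: eq_bigr => c' _.
  rewrite [(y c' * _)^*]rmorphM /= -eeN opprK mulrBr rmorphB /= mulrBl eeD.
  by move: (ee _) (ee _) => e1 e2; ring.
rewrite exchange_big /=.
transitivity ((9^-1)%:C * \sum_(c <- B) 3 * (y c * (y c)^*)).
  congr (_ * _); rewrite big_seq [RHS]big_seq; apply: eq_bigr => c cB.
  rewrite exchange_big /=.
  transitivity (\sum_(c' <- B) y c * (y c')^* * (3 * (c' == c)%:R)).
    rewrite big_seq [RHS]big_seq; apply: eq_bigr => c' c'B.
    by rewrite -mulr_sumr -gramE.
  rewrite (bigD1_seq c) //= eqxx mulr1 big1 ?addr0; first ring.
  by move=> c' /negbTE ->; rewrite !mulr0.
rewrite -mulr_sumr mulrA; congr (_ * _).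
  by rewrite -[3](rmorph_nat (real_complex R)) -rmorphM /=; congr (_%:C); field.
by apply: eq_bigr => c _; rewrite -sqmodE.
Qed.

Lemma sum_nrm2_branch v : L2fun mu v ->
  \sum_(l <- L) sqmod (alpha l) * nrm2 (branch l v) = nrm2 v.
Proof.
move=> hv; rewrite [RHS](self_similar_Rintegral ss (L2fun_integrable hv)).
have hi (l : int) := L2fun_integrable (L2fun_branch l hv).
transitivity (Rintegral mu setT (fun x => \sum_(l <- L) sqmod (alpha l) * sqmod (branch l v x))).
  rewrite Rint_sum; last by move=> l; exact: RintgZ.
  by apply: eq_bigr => l _; rewrite RintegralZl.
under eq_Rintegral do rewrite sum_sqmod_branch big_seq.
pose F c x : R := if c \in B then sqmod (v (tau c x)) else 0.
have Fi c : mu.-integrable setT (EFin \o F c).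
  rewrite /F; have [cB|cB] := boolP (c \in B); last exact: Rintg_cst.
  exact: (L2fun_integrable (L2fun_tau cB hv)).
transitivity (Rintegral mu setT (fun x => 3^-1 * \sum_(c <- B) F c x)).
  apply: eq_Rintegral => x _; congr (_ * _).
  by rewrite [RHS]big_seq; apply: eq_bigr => c cB; rewrite /F cB.
rewrite RintegralZl //; last exact: Rintg_sum.
rewrite Rint_sum //; congr (_ * _); rewrite big_seq [RHS]big_seq.
by apply: eq_bigr => c cB; rewrite /F cB.
Qed.

Definition defect (n : nat) v : R := nrm2 v -
  \sum_(w <- Omega_le L n) sqmod (\prod_(l <- w) alpha l) * sqmod (coef v (freq Rn w)).

Lemma defectS n v : L2fun mu v ->
  defect n.+1 v = \sum_(l <- L) sqmod (alpha l) * defect n (branch l v).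
Proof.
move=> hv; rewrite /defect /=.
under [RHS]eq_bigr do rewrite mulrBr.
rewrite sumrB sum_nrm2_branch //; congr (_ - _).
rewrite big_allpairs_dep /=; apply: eq_bigr => l _; rewrite mulr_sumr.
apply: eq_bigr => w _; rewrite prod_wcons // freq_wcons coef_branch // sqmodM.
by rewrite mulrA.
Qed.

Lemma defect_ge0 n v : L2fun mu v -> 0 <= defect n v.
Proof.
elim: n v => [|n IH] v hv.
  (* At level 0 only the empty word counts, and the claim is Cauchy-Schwarz against a function of
     modulus 1. *)
  rewrite /defect /= big_seq1 big_nil sqmod1 mul1r subr_ge0.
  rewrite (le_trans (sqmod_cintegral_le (L2fun_mulee _ hv))) //.
  by rewrite le_eqVlt; apply/orP; left; apply/eqP/eq_nrm2 => x; rewrite sqmodM sqmod_ee mulr1.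
rewrite defectS // sumr_ge0 // => l _.
by rewrite mulr_ge0 ?sqmod_ge0 // IH //; exact: L2fun_branch.
Qed.

Lemma defect_le_nrm2 n v : defect n v <= nrm2 v.
Proof.
by rewrite /defect gerBl sumr_ge0 // => w _; rewrite mulr_ge0 ?sqmod_ge0.
Qed.

Lemma defect_antitone n m v : (n <= m)%N -> defect m v <= defect n v.
Proof.
move=> nm; rewrite /defect lerB //; apply: ler_sum_uniq_subset; try exact: uniq_Omega_le.
  by move=> w; rewrite !mem_Omega_le // => /andP[-> h]; exact: leq_trans h nm.
by move=> w; rewrite mulr_ge0 ?sqmod_ge0.
Qed.

Lemma coefD u v k : L2fun mu u -> L2fun mu v ->
  coef (fun x => u x + v x) k = coef u k + coef v k.
Proof.
move=> hu hv; rewrite /coef -cintegralD; try exact: L2fun_mulee.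
by apply: eq_cintegral => x; rewrite mulrDl.
Qed.

Lemma coefZ (c : R[i]) v k : L2fun mu v -> coef (fun x => c * v x) k = c * coef v k.
Proof.
move=> hv; rewrite /coef -cintegralZ; last exact: L2fun_mulee.
by apply: eq_cintegral => x; rewrite mulrA.
Qed.

Lemma defectZ n (c : R[i]) v : L2fun mu v -> defect n (fun x => c * v x) = sqmod c * defect n v.
Proof.
move=> hv; rewrite /defect nrm2Z // mulrBr mulr_sumr; congr (_ - _).
by apply: eq_bigr => w _; rewrite coefZ // sqmodM mulrCA.
Qed.

(** The defect is a quadratic form, so it satisfies the weighted parallelogram law exactly; the term
    discarded is the defect of [w], which is nonnegative. *)
Lemma defectD_le n (a : R) u v : a != 0 -> L2fun mu u -> L2fun mu v ->
  defect n (fun x => u x + v x) <=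
  (1 + a ^+ 2) * defect n u + (1 + a ^- 2) * defect n v.
Proof.
move=> a0 hu hv.
pose w x := a%:C * u x + (- a^-1)%:C * v x.
have hw : L2fun mu w by apply: L2funD; exact: L2funZ.
rewrite -(lerD2r (defect n w)); apply: (@le_trans _ _
  ((1 + a ^+ 2) * defect n u + (1 + a ^- 2) * defect n v)); last first.
  by rewrite lerDl defect_ge0.
rewrite le_eqVlt; apply/orP; left; apply/eqP.
have := nrm2_parallelogram a0 hu hv.
have -> : (fun x => a%:C * u x - (a^-1)%:C * v x) = w.
  by apply/funext => x; rewrite /w rmorphN mulNr.
rewrite /defect => nE; rewrite addrACA nE !mulrBr [RHS]addrACA; congr (_ + _).
rewrite -!opprD; congr (- _); rewrite !mulr_sumr -!big_split /=; apply: eq_bigr => i _.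
rewrite /w coefD // coefD; try exact: L2funZ.
rewrite !coefZ // rmorphN mulNr -mulrDr sqmod_parallelogram //; ring.
Qed.

End FrameDefect.

Lemma cvg_sum_seq (R : realType) (I : Type) (s : seq I) (F : I -> nat -> R) (l : I -> R) :
  (forall i, F i n @[n --> \oo] --> l i) ->
  \sum_(i <- s) F i n @[n --> \oo] --> \sum_(i <- s) l i.
Proof.
move=> h; elim: s => [|i s IH].
  by under eq_cvg do rewrite big_nil; rewrite big_nil; exact: cvg_cst.
by under eq_cvg do rewrite big_cons; rewrite big_cons; exact: cvgD.
Qed.

(** * The limit defect of exponentials: harmonicity and continuity *)

Section ExponentialDefect.
Variables (R : realType) (mu : probability R R) (Rn : int) (B L : seq int)
  (alpha : int -> R[i]).
Hypotheses (Rn0 : Rn != 0) (uB : uniq B) (uL : uniq L) (L0 : 0 \in L)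
  (alpha0 : alpha 0 = 1) (ss : self_similar mu Rn B).
Hypothesis gramE :
  forall c c', c \in B -> c' \in B -> gram Rn L alpha (c - c') = 3 * (c == c')%:R.

Local Notation nrm2 := (nrm2 mu).
Local Notation defect := (defect mu Rn L alpha).
Local Notation branch := (branch (R := R) Rn B).

Let Rn0' : (Rn%:~R : R) != 0.
Proof. by rewrite intr_eq0. Qed.

Definition ex (t : R) : R -> R[i] := fun x => ee (t * x).

(** The scalar that appears when a branch is applied to an exponential, see [branch_ex]. *)
Definition mask (x : R) : R[i] := 3^-1 * \sum_(c <- B) ee (c%:~R * x).

Definition child (l : int) (t : R) : R := (t - l%:~R) / Rn%:~R.

Definition weight (l : int) (t : R) : R := sqmod (alpha l) * sqmod (mask (child l t)).

Lemma weight_ge0 l t : 0 <= weight l t.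
Proof. by rewrite mulr_ge0 ?sqmod_ge0. Qed.

Lemma nrm2_ex t : nrm2 (ex t) = 1.
Proof.
rewrite /nrm2; under eq_Rintegral do rewrite sqmod_ee.
exact: Rint_cst.
Qed.

Lemma branch_ex l t : branch l (ex t) = fun x => mask (child l t) * ex (child l t) x.
Proof.
apply/funext => x; rewrite /branch /mask -mulrA; congr (_ * _); rewrite mulr_suml.
apply: eq_bigr => c _; rewrite /ex -!eeD; congr ee.
by rewrite /child /tau; field.
Qed.

(** This is the norm identity for the branches of [e_t], exponentials having norm 1; the weights are
    thus transition probabilities. *)
Lemma sum_weight t : \sum_(l <- L) weight l t = 1.
Proof.
rewrite -(nrm2_ex t) -(sum_nrm2_branch Rn0 uB ss gramE (L2fun_ee mu t)).
apply: eq_bigr => l _; rewrite /weight -/(ex t) branch_ex nrm2Z; last exact: L2fun_ee.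
by rewrite nrm2_ex mulr1.
Qed.

Lemma defectS_ex n t : defect n.+1 (ex t) =
  \sum_(l <- L) weight l t * defect n (ex (child l t)).
Proof.
rewrite (defectS Rn0 uB alpha0 ss gramE n (L2fun_ee mu t)); apply: eq_bigr => l _.
by rewrite -/(ex t) branch_ex defectZ ?mulrA //; exact: L2fun_ee.
Qed.

Lemma defect_ex_ge0 n t : 0 <= defect n (ex t).
Proof. exact: (defect_ge0 Rn0 uB alpha0 ss gramE n (L2fun_ee mu t)). Qed.

Definition limdef (t : R) : R := inf (range (fun n => defect n (ex t))).

Lemma cvg_limdef t : defect n (ex t) @[n --> \oo] --> limdef t.
Proof.
apply: nonincreasing_cvgn; first by move=> n m; exact: defect_antitone.
by exists 0 => _ [n _ <-]; exact: defect_ex_ge0.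
Qed.

Lemma limdef_le n t : limdef t <= defect n (ex t).
Proof.
apply: ge_inf; last by exists n.
by exists 0 => _ [m _ <-]; exact: defect_ex_ge0.
Qed.

Lemma limdef_ge0 t : 0 <= limdef t.
Proof.
apply: lb_le_inf; first by exists (defect 0 (ex t)); exists 0%N.
by move=> _ [n _ <-]; exact: defect_ex_ge0.
Qed.

Lemma limdef_le1 t : limdef t <= 1.
Proof.
by rewrite (le_trans (limdef_le 0 t)) // -(nrm2_ex t) defect_le_nrm2.
Qed.

(** The constant function 1 is the frame element of the empty word, so its defect vanishes already
    at level 0. *)
Lemma limdef0 : limdef 0 = 0.
Proof.
apply/eqP; rewrite eq_le limdef_ge0 andbT (le_trans (limdef_le 0 0)) //.
rewrite /defect /= big_seq1 big_nil sqmod1 mul1r nrm2_ex.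
suff -> : coef mu (ex 0) (freq Rn [::]) = 1 by rewrite sqmod1 subrr.
rewrite /coef /freq big_ord0 /cintegral /ex.
by do 2!(under eq_Rintegral do rewrite mul0r ee0 mul1r oppr0 mul0r ee0; rewrite Rint_cst).
Qed.

Lemma limdef_harmonic t : limdef t = \sum_(l <- L) weight l t * limdef (child l t).
Proof.
have h1 : defect n.+1 (ex t) @[n --> \oo] --> limdef t.
  by have := @cvg_limdef t; rewrite -(cvg_shiftS (fun n => defect n (ex t))).
have h2 : defect n.+1 (ex t) @[n --> \oo] -->
    \sum_(l <- L) weight l t * limdef (child l t).
  under eq_cvg do rewrite defectS_ex.
  apply: (cvg_sum_seq (F := fun l n => weight l t * defect n (ex (child l t)))) => l.
  by apply: cvgMl_tmp; exact: cvg_limdef.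
exact: (cvg_unique _ h1 h2).
Qed.

(** The squared distance in L^2 between [e_t] and [e_s] when [h = t - s]. *)
Definition gap (h : R) : R := Rintegral mu setT (fun x => sqmod (ee (h * x) - 1)).

Lemma gap_small (e : R) : 0 < e -> exists2 d, 0 < d & forall h, `|h| < d -> gap h < e.
Proof.
move=> e0.
have gap0 : gap 0 = 0.
  rewrite /gap; under eq_Rintegral do rewrite mul0r ee0 subrr sqmod0.
  exact: Rint_cst.
have sE h x : sqmod (ee (h * x) - 1) = 2 - 2 * cos (2 * pi * (h * x)) :> R.
  rewrite /sqmod /= oppr0 addr0.
  by have := cos2Dsin2 (2 * pi * (h * x)); lra.
have hc : {for 0, continuous gap}.
  have := @continuity_under_integral _ _ _ mu (fun h x : R => sqmod (ee (h * x) - 1)) setT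
    measurableT (-1) 1.
  (* The integrand is [2 - 2 cos], hence dominated by 4. *)
  move=> /(_ _ _ (fun=> 4)) H; apply: H; last by rewrite inE /= in_itv /= ltrN10 ltr01.
  - move=> h _; apply: (@L2fun_integrable _ mu (fun x => ee (h * x) - 1)).
    by apply: L2funD; [exact: L2fun_ee | apply: L2fun_bounded (cmeas_cst _) (fun=> lexx _)].
  - apply: aeW => x _ h _; under eq_fun do rewrite sE.
    apply: cvgB; first exact: cvg_cst.
    apply: cvgM; first exact: cvg_cst.
    apply: (@continuous_cvg _ _ _ _ _ (fun h : R => 2 * pi * (h * x)) cos); first exact: continuous_cos.
    apply: cvgM; first exact: cvg_cst.
    by apply: cvgM; [exact: cvg_id | exact: cvg_cst].
  - exact: Rintg_cst.
  - move=> h _; apply: aeW => x _; rewrite ger0_norm ?sqmod_ge0 // sE.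
    by have := cos_geN1 (2 * pi * (h * x)); lra.
move: hc => /cvgrPdist_lt /(_ _ e0) /nbhs_ballP[d /= d0 hd].
exists d => // h hh; have := hd h; rewrite gap0 /ball /= sub0r normrN => /(_ hh).
by rewrite sub0r normrN; apply: le_lt_trans; exact: ler_norm.
Qed.

(** Split [e_t = e_s + (e_t - e_s)] and bound the defect of the difference by its squared norm. *)
Lemma limdef_le_gap (a s t : R) : a != 0 ->
  limdef t <= (1 + a ^+ 2) * limdef s + (1 + a ^- 2) * gap (t - s).
Proof.
move=> a0.
have : (1 + a ^+ 2) * defect n (ex s) + (1 + a ^- 2) * gap (t - s) @[n --> \oo] -->
   (1 + a ^+ 2) * limdef s + (1 + a ^- 2) * gap (t - s).
  by apply: cvgD; [apply: cvgMl_tmp; exact: cvg_limdef | exact: cvg_cst].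
move=> h; apply: (ler_cvg_to (cvg_cst (limdef t)) h); apply: nearW => n /=.
apply: le_trans (limdef_le n t) _.
have e1 : L2fun mu (fun x => ex t x - ex s x).
  have := L2funD (L2fun_ee mu t) (L2funZ (-1) (L2fun_ee mu s)).
  by under eq_fun do rewrite mulN1r.
have -> : ex t = fun x => ex s x + (ex t x - ex s x) by apply/funext => x; ring.
apply: le_trans (defectD_le Rn0 uB alpha0 ss gramE n a0 (L2fun_ee mu s) e1) _.
rewrite lerD2l ler_wpM2l ?addr_ge0 ?invr_ge0 ?sqr_ge0 //.
apply: le_trans (defect_le_nrm2 _ _ _ _ _ _) _; rewrite le_eqVlt; apply/orP; left; apply/eqP.
apply: eq_Rintegral => x _.
rewrite (_ : ex t x - ex s x = ex s x * (ee ((t - s) * x) - 1)) ?sqmodM ?sqmod_ee ?mul1r //.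
by rewrite mulrBr mulr1 /ex -eeD; congr (ee _ - _); ring.
Qed.

Lemma continuous_limdef : continuous limdef.
Proof.
move=> s; apply/cvgrPdist_lt => e e0.
(* As [limdef] is at most 1, the factor [1 + a^2] costs at most [e / 4]; the radius [d] is then
   chosen so that the gap term also costs at most [e / 4]. *)
pose a := Num.sqrt (e / 4).
have e4 : 0 < e / 4 by rewrite divr_gt0.
have a0 : a != 0 by rewrite gt_eqF // sqrtr_gt0.
have a2 : a ^+ 2 = e / 4 by rewrite sqr_sqrtr // ltW.
have b0 : 0 < 1 + a ^- 2 by rewrite ltr_pwDl // invr_ge0 sqr_ge0.
have [d d0 hd] := gap_small (divr_gt0 e4 b0).
near=> t.
have key x y : `|x - y| < d -> limdef x <= limdef y + e / 2.
  move=> xy; apply: le_trans (limdef_le_gap y x a0) _.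
  have h1 : (1 + a ^- 2) * gap (x - y) <= e / 4.
    by rewrite mulrC -ler_pdivlMr // ltW // hd.
  have h2 : a ^+ 2 * limdef y <= e / 4.
    by rewrite a2 ler_piMr ?limdef_le1 // ltW.
  by rewrite mulrDl mul1r; lra.
have ts : `|t - s| < d.
  by near: t; apply/nbhs_ballP; exists d => //= t; rewrite /ball /= distrC.
have := key t s ts; have := key s t; rewrite distrC => /(_ ts).
by rewrite ltr_norml; lra.
Unshelve. all: by end_near. Qed.

End ExponentialDefect.

(** * Denominators of rational points *)

Section Denominator.
Variable R : realType.
Implicit Types (t : R) (q : nat).

(** The denominator of [t] in lowest terms, characterized by minimality; its existence makes [t]
    rational. *)
Definition is_den t q := [/\ (0 < q)%N, q%:R * t \is a Num.int &
  forall q', (0 < q')%N -> q'%:R * t \is a Num.int -> (q <= q')%N].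

Lemma is_den_exists t (D : nat) : (0 < D)%N -> D%:R * t \is a Num.int ->
  exists2 q, is_den t q & (q <= D)%N.
Proof.
move=> D0 Dt.
have ex : exists q, (0 < q)%N && (q%:R * t \is a Num.int) by exists D; rewrite D0.
case: (ex_minnP ex) => q /andP[q0 qt] qmin; exists q; last by apply: qmin; rewrite D0.
by split => // q' q'0 q't; apply: qmin; rewrite q'0.
Qed.

(* If N t' is an integer then so is (N / gcd(N, Rn)) t, so minimality of N for t
   forces gcd(N, Rn) = 1. *)
Lemma is_den_coprime t t' (Rn l : int) (N : nat) : is_den t N -> N%:R * t' \is a Num.int ->
  t = Rn%:~R * t' + l%:~R -> coprime N `|Rn|%N.
Proof.
move=> [N0 Nt Nmin] Nt' tE; set d := gcdn N `|Rn|%N.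
have d0 : (0 < d)%N by rewrite gcdn_gt0 N0.
have dN : (d %| N)%N by exact: dvdn_gcdl.
have /dvdzP[k Rk] : (d%:Z %| Rn)%Z by rewrite dvdzE /= dvdn_gcdr.
have Nd0 : (0 < N %/ d)%N by rewrite divn_gt0 // dvdn_leq.
have : (N <= N %/ d)%N.
  apply: Nmin => //.
  have -> : (N %/ d)%:R * t = k%:~R * (N%:R * t') + (N %/ d)%:R * l%:~R.
    rewrite -{2}(divnK dN) natrM tE Rk rmorphM /= -pmulrn; ring.
  by rewrite rpredD // rpredM // ?intr_int ?natr_int.
rewrite /coprime -/d => h.
have : (N %/ d * d <= N %/ d)%N by rewrite divnK.
by rewrite -[leqRHS]muln1 leq_pmul2l // => d1; rewrite eqn_leq d1.
Qed.

Lemma coprime_int (N : nat) (Rn : int) t : coprime N `|Rn|%N -> N%:R * t \is a Num.int ->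
  Rn%:~R * t \is a Num.int -> t \is a Num.int.
Proof.
move=> cop Nt Rt.
have cop' : coprimez N%:Z Rn by rewrite coprimezE.
have [[u v] /= uv] := coprimezP _ _ cop'.
have -> : t = u%:~R * (N%:R * t) + v%:~R * (Rn%:~R * t).
  rewrite -[LHS]mul1r -[1 in LHS]/(1%:~R) -uv rmorphD !rmorphM /= -pmulrn; ring.
by rewrite rpredD // rpredM // intr_int.
Qed.

End Denominator.

(** * The limit defect has no positive maximum *)

Section MaximumPrinciple.
Variables (R : realType) (mu : probability R R) (Rn : int) (B L : seq int)
  (alpha : int -> R[i]) (D : nat).
Hypotheses (Rn2 : 2 <= `|Rn|) (uB : uniq B) (uL : uniq L) (L0 : 0 \in L)
  (alphaN0 : forall l, l \in L -> alpha l != 0)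
  (alpha0 : alpha 0 = 1) (ss : self_similar mu Rn B).
Hypothesis gramE :
  forall c c', c \in B -> c' \in B -> gram Rn L alpha (c - c') = 3 * (c == c')%:R.
Local Notation mask := (@mask R B).
Local Notation child := (@child R Rn).
Local Notation weight := (@weight R Rn B alpha).
Local Notation limdef := (limdef mu Rn L alpha).

Hypotheses (D_gt0 : (0 < D)%N)
  (mask_eq0 : forall x, mask x = 0 -> D%:R * x \is a Num.int)
  (branching : forall t l, l \in L -> l != 0 -> mask (child l t) != 0 ->
     exists l1 l2, [/\ l1 \in L, l2 \in L, mask (child l1 t) != 0,
        mask (child l2 t) != 0 & (l1 != l2 %[mod Rn])%Z]).

Let Rn0 : Rn != 0.
Proof. by move: Rn2; case: eqP => // ->. Qed.

Let Rn0' : (Rn%:~R : R) != 0.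
Proof. by rewrite intr_eq0. Qed.

Let Rn2' : 2 <= `|Rn%:~R : R|.
Proof. by rewrite -intr_norm -[2]/(2%:~R) ler_int. Qed.

Section Maximizers.
Variables (K M : R).
Hypotheses (KL : forall l, l \in L -> `|l%:~R : R| <= K) (M0 : 0 < M)
  (Mmax : forall t, `|t| <= K -> limdef t <= M).

Definition maximizer t := `|t| <= K /\ limdef t = M.

(** A weighted average of values at most [M] equals [M] only if every value of positive weight is
    [M]. The children stay in [-K, K] because [|t - l| <= 2 K <= |Rn| K]. *)
Lemma maximizer_child t l : maximizer t -> l \in L -> mask (child l t) != 0 ->
  maximizer (child l t).
Proof.
move=> [tK tM] lL ml.
have cK l' : l' \in L -> `|child l' t| <= K.
  move=> l'L; rewrite /child normrM normfV ler_pdivrMr ?normr_gt0 //.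
  have := ler_normB t l'%:~R; have := KL l'L; have := normr_ge0 t.
  by move: Rn2' tK; nra.
split; first exact: cK.
have /eqP : \sum_(l' <- L) weight l' t * (M - limdef (child l' t)) = 0.
  under eq_bigr do rewrite mulrBr.
  rewrite sumrB -mulr_suml (sum_weight Rn0 uB ss gramE) mul1r.
  by rewrite -(limdef_harmonic Rn0 uB uL L0 alpha0 ss gramE) tM subrr.
rewrite big_seq psumr_eq0; last first.
  by move=> l' l'L; rewrite mulr_ge0 ?weight_ge0 // subr_ge0 Mmax // cK.
move=> /allP/(_ l lL); rewrite lL /= !mulf_eq0 !sqmod_eq0 (negbTE (alphaN0 lL)) (negbTE ml) /=.
by rewrite subr_eq0 => /eqP <-.
Qed.

Lemma maximizer_orbit t : ~ (forall n, maximizer (t / Rn%:~R ^+ n)).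
Proof.
move=> h.
have hM n : limdef (t / Rn%:~R ^+ n) = M by have [] := h n.
have h0 : t / Rn%:~R ^+ n @[n --> \oo] --> (0 : R).
  rewrite -[X in _ --> X](mulr0 t); apply: cvgMl_tmp.
  under eq_cvg do rewrite -exprVn.
  apply: cvg_expr; rewrite normfV.
  by rewrite invf_lt1 ?normr_gt0 //; apply: lt_le_trans Rn2'; rewrite ltr1n.
have := continuous_limdef Rn0 uB uL L0 alpha0 ss gramE (x := 0).
rewrite /continuous_at => hc.
have h1 : limdef (t / Rn%:~R ^+ n) @[n --> \oo] --> limdef 0.
  exact: (cvg_comp _ _ h0 hc).
have M00 : M = limdef 0.
  have h2 : limdef (t / Rn%:~R ^+ n) @[n --> \oo] --> M.
    by under eq_cvg do rewrite hM; exact: cvg_cst.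
  exact: (cvg_unique _ h2 h1).
by move: M0; rewrite M00 (limdef0 Rn0 uB alpha0 ss gramE) ltxx.
Qed.

(** If [D t] is not an integer, neither is [D t / Rn^n] for any [n], so the mask vanishes nowhere
    along the orbit of [child 0], and the whole orbit consists of maximizers. *)
Lemma maximizer_rational t : maximizer t -> D%:R * t \is a Num.int.
Proof.
move=> mt; apply: contrapT => nint.
apply: (@maximizer_orbit t); elim => [|n IH]; first by rewrite expr0 divr1.
rewrite exprSr invfM mulrA.
have -> : t / Rn%:~R ^+ n / Rn%:~R = child 0 (t / Rn%:~R ^+ n).
  by rewrite /child subr0.
apply: maximizer_child => //; apply/eqP => /mask_eq0.
rewrite /child subr0 => hD; apply: nint.
have -> : D%:R * t = Rn%:~R ^+ n.+1 * (D%:R * (t / Rn%:~R ^+ n / Rn%:~R)).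
  by rewrite exprS; field; rewrite Rn0' expf_neq0.
by rewrite rpredM // rpredX // intr_int.
Qed.

Lemma no_maximizer t : ~ maximizer t.
Proof.
move=> mt.
pose P (N : nat) := `[< exists t, maximizer t /\ is_den t N >].
have Pub N : P N -> (N <= D)%N.
  move=> /asboolP[t' [mt' [_ _ hmin]]]; apply: hmin => //; exact: maximizer_rational.
have exP : exists N, P N.
  have [q hq _] := is_den_exists D_gt0 (maximizer_rational mt).
  by exists q; apply/asboolP; exists t.
(* [N] is the largest denominator of a maximizer, which exists because all of them are at most
   [D]. *)
have [N /asboolP[t1 [mt1 dt1]] Nmax] := ex_maxnP exP Pub.
have childE t' l : t' = Rn%:~R * child l t' + l%:~R :> R.
  by rewrite /child; field.
have den_child t' l : is_den t' N -> maximizer t' -> l \in L -> mask (child l t') != 0 ->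
    maximizer (child l t') /\ is_den (child l t') N.
  move=> [N0 Nt Nmin] mt' lL ml; have mc := maximizer_child mt' lL ml.
  split => //.
  have [q dq _] := is_den_exists D_gt0 (maximizer_rational mc).
  have qN : (q <= N)%N by apply: Nmax; apply/asboolP; exists (child l t').
  (* The denominator [q] of the child also clears [t' = Rn * child + l]. *)
  have Nq : (N <= q)%N.
    case: dq => q0 qc _; apply: Nmin => //; rewrite (childE t' l).
    rewrite mulrDr mulrCA rpredD // rpredM // ?intr_int ?natr_int //.
  by have <- : q = N by apply/eqP; rewrite eqn_leq qN.
have step t' : is_den t' N -> maximizer t' ->
    maximizer (t' / Rn%:~R) /\ is_den (t' / Rn%:~R) N.
  move=> dt' mt'.
  have -> : t' / Rn%:~R = child 0 t' by rewrite /child subr0.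
  apply: (den_child _ 0) => //; apply/eqP => m0.
  (* If the child 0 had mask 0, either some nonzero [l] has positive weight, and [branching] gives
     two such children incongruent modulo [Rn], or all weights vanish although their sum is 1. *)
  have [/hasP[l lL /andP[l0 ml]]|/hasPn hL] :=
      boolP (has (fun l => (l != 0) && (mask (child l t') != 0)) L).
    have [l1 [l2 [l1L l2L m1 m2 /negP]]] := branching lL l0 ml; apply.
    have [_ [N0 N1 _]] := den_child _ _ dt' mt' l1L m1.
    have [_ [_ N2 _]] := den_child _ _ dt' mt' l2L m2.
    have cop := is_den_coprime dt' N1 (childE t' l1).
    (* Both [N] and [Rn] times this difference are integers and [N] is prime to [Rn]; then [l2 - l1]
       is [Rn] times an integer, which [branching] excludes. *)
    have : child l1 t' - child l2 t' \is a Num.int.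
      apply: (coprime_int cop); first by rewrite mulrBr rpredB.
      rewrite (_ : _ * _ = l2%:~R - l1%:~R) ?rpredB ?intr_int //.
      by rewrite /child; field.
    move=> /intrP[j hj]; rewrite eq_sym eqz_mod_dvd; apply/dvdzP; exists j.
    apply: (@intr_inj R); rewrite rmorphB rmorphM /= -hj /child; field.
    exact: Rn0'.
  have := sum_weight Rn0 uB ss gramE t'.
  rewrite big1_seq => [/eqP|l /andP[_ lL]]; first by rewrite eq_sym oner_eq0.
  rewrite /weight; have [->|l0] := eqVneq l 0; first by rewrite m0 sqmod0 mulr0.
  by have := hL l lL; rewrite l0 /= negbK => /eqP ->; rewrite sqmod0 mulr0.
apply: (@maximizer_orbit t1) => n.
suff [] : maximizer (t1 / Rn%:~R ^+ n) /\ is_den (t1 / Rn%:~R ^+ n) N by [].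
elim: n => [|n [IH1 IH2]]; first by rewrite expr0 divr1.
by rewrite exprSr invfM mulrA; exact: step.
Qed.

End Maximizers.

Lemma limdef_eq0 t : limdef t = 0.
Proof.
have [//|t0] := eqVneq (limdef t) 0.
have t_gt0 : 0 < limdef t.
  by rewrite lt_neqAle eq_sym t0 (limdef_ge0 Rn0 uB alpha0 ss gramE).
(* [K] bounds both [t] and all the [l]: the maximum over [-K, K] is positive and the interval is
   stable under children. *)
pose K : R := `|t| + \sum_(l <- L) `|l%:~R|.
have KL l : l \in L -> `|l%:~R| <= K.
  move=> lL; rewrite /K (big_rem l) //= addrCA lerDl addr_ge0 // sumr_ge0 //.
have tK : `|t| <= K by rewrite lerDl sumr_ge0.
have K0 : - K <= K by rewrite ge0_cp // (le_trans _ tK).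
have cont : {within `[- K, K], continuous limdef}.
  exact: continuous_subspaceT (continuous_limdef Rn0 uB uL L0 alpha0 ss gramE).
have [c cK cmax] := EVT_max K0 cont.
have inK s : (s \in `[- K, K]) = (`|s| <= K) by rewrite in_itv /= ler_norml.
exfalso; apply: (@no_maximizer K (limdef c) KL _ _ c).
- by apply: lt_le_trans t_gt0 _; apply: cmax; rewrite inK.
- by move=> s sK; apply: cmax; rewrite inK.
- by split => //; rewrite -inK.
Qed.

End MaximumPrinciple.

(** * Polynomials converging to the indicator of positivity on [-1, 1] *)

Section PositivityPolynomial.
Variable R : realType.
Implicit Types (y : R) (n : nat).

(* phi maps [-1, 1] to itself with fixed points -1, 0, 1, and its iterates converge
   there to the sign function. *)
Definition phi y := (3 * y - y ^+ 3) / 2.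

Lemma phiN y : phi (- y) = - phi y.
Proof. by rewrite /phi; field. Qed.

Lemma iter_phiN n y : iter n phi (- y) = - iter n phi y.
Proof. by elim: n => //= n ->; exact: phiN. Qed.

Lemma iter_phi0 n : iter n phi 0 = 0.
Proof. by elim: n => //= n ->; rewrite /phi; ring. Qed.

Lemma iter_phi_itv n y : 0 < y <= 1 -> y <= iter n phi y <= 1.
Proof.
move=> /andP[y0 y1]; elim: n => [|n /= /andP[h1 h2]]; first by rewrite /= lexx.
set z := iter n phi y in h1 h2 *.
have e1 : 1 - phi z = (1 - z) ^+ 2 * (2 + z) / 2 by rewrite /phi; field.
have e2 : phi z - z = z * (1 - z) * (1 + z) / 2 by rewrite /phi; field.
have p1 : 0 <= (1 - z) ^+ 2 * (2 + z) / 2.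
  by rewrite divr_ge0 // mulr_ge0 ?sqr_ge0 //; lra.
have p2 : 0 <= z * (1 - z) * (1 + z) / 2.
  by rewrite divr_ge0 // mulr_ge0 // ?mulr_ge0 //; lra.
by apply/andP; split; lra.
Qed.

(** [1 - phi z] is [1 - z] times [1 - (z + z^2) / 2], and the iterates [z] stay above [y]. *)
Lemma iter_phi_rate n y : 0 < y <= 1 -> 1 - iter n phi y <= (1 - y / 2) ^+ n.
Proof.
move=> hy; elim: n => [|n IH]; first by rewrite /= expr0; case/andP: hy; lra.
have /andP[h1 h2] := iter_phi_itv n hy; move: hy => /andP[y0 y1] /=.
set z := iter n phi y in h1 h2 IH *.
have -> : 1 - phi z = (1 - (z + z ^+ 2) / 2) * (1 - z) by rewrite /phi; field.
rewrite [leRHS]exprS; apply: ler_pM => //; last by have := sqr_ge0 z; lra.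
  have : z ^+ 2 <= 1 by rewrite exprn_ile1 //; lra.
  by lra.
by lra.
Qed.

Lemma cvg_iter_phi y : 0 < y <= 1 -> iter n phi y @[n --> \oo] --> (1 : R).
Proof.
move=> hy; have h : 1 - (1 - y / 2) ^+ n @[n --> \oo] --> (1 : R).
  rewrite -[X in _ --> X]subr0; apply: cvgB; first exact: cvg_cst.
  by apply: cvg_expr; rewrite ger0_norm; case/andP: hy; lra.
apply: (squeeze_cvgr _ h (cvg_cst (1 : R))); apply: nearW => n.
have /andP[_ ->] := iter_phi_itv n hy; rewrite andbT.
by have := iter_phi_rate n hy; lra.
Qed.

(** [(s + s^2) / 2] sends the signs -1, 0, 1 to 0, 0, 1. *)
Definition pos_approx n y := (iter n phi y + iter n phi y ^+ 2) / 2.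

Lemma pos_approx_bound n y : `|y| <= 1 -> `|pos_approx n y| <= 1.
Proof.
move=> y1; suff : `|iter n phi y| <= 1.
  rewrite /pos_approx; set z := iter n phi y; rewrite !ler_norml => /andP[h1 h2].
  have : z ^+ 2 <= 1 by nra.
  have := sqr_ge0 z; lra.
have [y0|y0|->] := ltgtP y 0; last by rewrite iter_phi0 normr0.
  rewrite -[y]opprK iter_phiN normrN.
  have /(iter_phi_itv n) : 0 < - y <= 1 by move: y1; rewrite ler_norml; lra.
  by rewrite ler_norml; lra.
have /(iter_phi_itv n) : 0 < y <= 1 by move: y1; rewrite ler_norml; lra.
by rewrite ler_norml; lra.
Qed.

Lemma cvg_pos_approx y : `|y| <= 1 -> pos_approx n y @[n --> \oo] --> ((0 < y)%R%:R : R).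
Proof.
move=> y1.
have key (l : R) : iter n phi y @[n --> \oo] --> l ->
    pos_approx n y @[n --> \oo] --> (l + l ^+ 2) / 2.
  move=> h; apply: cvgMr_tmp; apply: cvgD => //.
  by under eq_cvg do rewrite expr2; rewrite expr2; exact: cvgM.
have [y0|y0|y0] := ltgtP y 0.
- have -> : false%:R = (-1 + (-1) ^+ 2) / 2 :> R by rewrite /=; field.
  apply: key; rewrite -[y]opprK; under eq_cvg do rewrite iter_phiN.
  by apply: cvgN; apply: cvg_iter_phi; move: y1; rewrite ler_norml; lra.
- have -> : true%:R = (1 + 1 ^+ 2) / 2 :> R by rewrite /=; field.
  by apply: key; apply: cvg_iter_phi; move: y1; rewrite ler_norml; lra.
- have -> : false%:R = (0 + 0 ^+ 2) / 2 :> R by rewrite /=; field.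
  by apply: key; rewrite y0; under eq_cvg do rewrite iter_phi0; exact: cvg_cst.
Qed.

End PositivityPolynomial.

(** * Density of the exponentials, as an induction principle for closed subspaces [P] *)

Section TrigonometricDensity.
Variables (R : realType) (mu : probability R R) (P : (R -> R[i]) -> Prop).
Implicit Types (u v : R -> R[i]).
Local Notation Rintg f := (mu.-integrable setT (EFin \o f)).

Hypotheses (P_ee : forall t, P (fun x => ee (t * x)))
  (P_add : forall u v, P u -> P v -> P (fun x => u x + v x))
  (P_scale : forall c v, P v -> P (fun x => c * v x))
  (P_closed : forall v, L2fun mu v ->
     (forall e, 0 < e -> exists2 g, P g & nrm2 mu (fun x => v x - g x) < e) -> P v).

Lemma P_cst (c : R[i]) : P (fun=> c).
Proof.
have := P_scale c (P_ee 0).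
by under eq_fun do rewrite mul0r ee0 mulr1.
Qed.

Lemma P_sum (I : Type) (s : seq I) (F : I -> R -> R[i]) :
  (forall i, P (F i)) -> P (fun x => \sum_(i <- s) F i x).
Proof.
move=> h; elim: s => [|i s IH].
  by under eq_fun do rewrite big_nil; exact: P_cst.
by under eq_fun do rewrite big_cons; exact: P_add.
Qed.

(** Pointwise convergence dominated by [G] in L^2 is convergence in L^2: the squared differences are
    dominated by [4 G^2]. *)
Lemma P_dominated (g : nat -> R -> R) (f G : R -> R) :
  (forall k, measurable_fun setT (g k)) -> (forall x, g k x @[k --> \oo] --> f x) ->
  (forall k x, `|g k x| <= G x) -> Rintg (fun x => G x ^+ 2) ->
  (forall k, P (fun x => (g k x)%:C)) -> P (fun x => (f x)%:C).
Proof.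
move=> mg gf gG Gi Pg.
have mf : measurable_fun setT f by apply: measurable_fun_cvg mg _ => x _; exact: gf.
have fG x : `|f x| <= G x.
  have h : `|g k x| @[k --> \oo] --> `|f x| by apply: cvg_norm; exact: gf.
  by apply: (ler_cvg_to h (cvg_cst (G x))); apply: nearW => k; exact: gG.
have fG2 x : f x ^+ 2 <= G x ^+ 2 by rewrite -real_normK ?num_real // lerXn2r ?nnegrE // (le_trans _ (fG x)).
have L2f : L2fun mu (fun x => (f x)%:C).
  apply: (L2fun_dom (cmeas_real mf) _ Gi) => x.
  by rewrite sqmod_real.
apply: P_closed => // e e0.
pose F k x : \bar R := ((f x - g k x) ^+ 2)%:E.
have [] := @dominated_convergence _ _ _ mu setT measurableT F (cst 0%E)
   (fun x => (4 * G x ^+ 2)%:E).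
- by move=> k; apply/measurable_EFinP/measurable_funX; exact: measurable_funB.
- exact: measurable_cst.
- apply: aeW => x _; rewrite /F; apply: cvg_EFin; first by apply: nearW.
  rewrite (_ : 0 = (f x - f x) ^+ 2); last by rewrite subrr expr0n.
  under eq_cvg do rewrite /= expr2.
  rewrite expr2; apply: cvgM; apply: cvgB; try exact: cvg_cst; exact: gf.
- exact: (RintgZ 4 Gi).
- apply: aeW => x k _; rewrite /F /= lee_fin ger0_norm ?sqr_ge0 //.
  have h1 := fG x; have h2 := gG k x.
  have -> : 4 * G x ^+ 2 = (2 * G x) ^+ 2 by ring.
  rewrite -real_normK ?num_real // lerXn2r ?nnegrE //.
    by rewrite mulr_ge0 // (le_trans _ h1).
  by rewrite (le_trans (ler_normB _ _)) //; lra.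
move=> _ _; rewrite integral0 => /fine_cvg /cvgrPdist_lt /(_ e e0) [k _ /(_ k (leqnn k))] /=.
rewrite sub0r normrN => hk; exists (fun x => (g k x)%:C); first exact: Pg.
apply: le_lt_trans hk; rewrite (le_trans _ (ler_norm _)) // /nrm2 /Rintegral.
rewrite le_eqVlt; apply/orP; left; apply/eqP; congr fine; apply: eq_integral => x _.
by rewrite /F -rmorphB sqmod_real.
Qed.

Definition trigpoly v := exists s : seq (R[i] * R),
  forall x, v x = \sum_(p <- s) p.1 * ee (p.2 * x).

Lemma P_trigpoly v : trigpoly v -> P v.
Proof.
move=> [s vE]; rewrite (_ : v = fun x => \sum_(p <- s) p.1 * ee (p.2 * x)); last exact/funext.
by apply: P_sum => p; apply: P_scale; exact: P_ee.
Qed.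

Lemma trigpoly_ee (c : R[i]) t : trigpoly (fun x => c * ee (t * x)).
Proof. by exists [:: (c, t)] => x; rewrite big_seq1. Qed.

Lemma trigpolyD u v : trigpoly u -> trigpoly v -> trigpoly (fun x => u x + v x).
Proof. by move=> [s us] [s' vs']; exists (s ++ s') => x; rewrite us vs' big_cat. Qed.

Lemma trigpolyM u v : trigpoly u -> trigpoly v -> trigpoly (fun x => u x * v x).
Proof.
move=> [s us] [s' vs'].
exists [seq (p.1 * p'.1, p.2 + p'.2) | p <- s, p' <- s'] => x.
rewrite us vs' big_allpairs_dep big_distrlr /=; apply: eq_bigr => p _; apply: eq_bigr => p' _.
by rewrite mulrDl eeD; ring.
Qed.

Lemma trigpolyZ (c : R[i]) v : trigpoly v -> trigpoly (fun x => c * v x).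
Proof.
move=> hv; have := trigpolyM (trigpoly_ee c 0) hv.
by under eq_fun do rewrite mul0r ee0 mulr1.
Qed.

Lemma trigpoly_sin (e a : R) : trigpoly (fun x => (sin (e * (x - a)))%:C).
Proof.
(* Frequency and phase in turns: [sin (e (x - a)) = cos (2 pi (s + t x))], the quarter turn in [s]
   converting sine to cosine. Introducing them by existentials keeps them opaque. *)
have [t tE] : exists t : R, t = e / (2 * pi) by eexists.
have [s sE] : exists s : R, s = - (e * a + pi / 2) / (2 * pi) by eexists.
have := trigpolyD (trigpoly_ee (2^-1 * ee s) t) (trigpoly_ee (2^-1 * ee (- s)) (- t)).
rewrite (_ : (fun x => _ + _) = (fun x => (sin (e * (x - a)))%:C)) //.
apply/funext => x; rewrite -!mulrA -!eeD -mulrDr.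
have -> : - s + - t * x = - (s + t * x) by ring.
have pi0 : (pi : R) != 0 by rewrite gt_eqF // pi_gt0.
have -> : sin (e * (x - a)) = cos (2 * pi * (s + t * x)).
  rewrite (_ : 2 * pi * _ = e * (x - a) - pi / 2); last first.
    by rewrite sE tE; move: pi0; move: (pi : R) => p p0; field.
  by rewrite cosB cos_pihalf sin_pihalf mulr0 mulr1 add0r.
rewrite eeN /ee /expi conjCE; apply/eqP.
rewrite (_ : 2^-1 = (2^-1)%:C) ?fmorphV ?rmorph_nat //.
by rewrite eq_complex /=; apply/andP; split; apply/eqP; field.
Qed.

(** Trigonometric polynomials form an algebra and [pos_approx n] is a polynomial. *)
Lemma trigpoly_pos_approx n (e a : R) :
  trigpoly (fun x => (pos_approx n (sin (e * (x - a))))%:C).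
Proof.
have hphi (g : R -> R) : trigpoly (fun x => (g x)%:C) -> trigpoly (fun x => (phi (g x))%:C).
  move=> h; have := trigpolyD (trigpolyZ (3 / 2)%:C h)
    (trigpolyZ (- 2^-1)%:C (trigpolyM h (trigpolyM h h))).
  rewrite (_ : (fun x => _ + _) = (fun x => (phi (g x))%:C)) //.
  by apply/funext => x; rewrite -!rmorphM -rmorphD /=; congr (_%:C); rewrite /phi; field.
have h : trigpoly (fun x => (iter n (@phi R) (sin (e * (x - a))))%:C).
  elim: n => [|n IH]; first exact: trigpoly_sin.
  exact: (hphi (fun x => iter n (@phi R) (sin (e * (x - a))))).
have := trigpolyZ (2^-1)%:C (trigpolyD h (trigpolyM h h)).
rewrite (_ : (fun x => _ * _) = (fun x => (pos_approx n (sin (e * (x - a))))%:C)) //.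
by apply/funext => x; rewrite -!rmorphM -rmorphD -rmorphM /=; congr (_%:C); rewrite /pos_approx; field.
Qed.

Lemma measurable_sin_affine (e a : R) : measurable_fun setT (fun x : R => sin (e * (x - a))).
Proof.
apply: (measurableT_comp (f := @sin R)).
  by apply: continuous_measurable_fun; exact: continuous_sin.
by apply: measurable_funM => //; exact: measurable_funB.
Qed.

Lemma measurable_pos_approx n (g : R -> R) : measurable_fun setT g ->
  measurable_fun setT (fun x => pos_approx n (g x)).
Proof.
move=> mg.
have h : measurable_fun setT (fun x => iter n (@phi R) (g x)).
  elim: n => //= n IH; apply: measurable_funM => //; apply: measurable_funB.
    exact: measurable_funM.
  exact: measurable_funX.
by apply: measurable_funM => //; apply: measurable_funD => //; exact: measurable_funX.
Qed.

Lemma sin_le1_norm (y : R) : `|sin y| <= 1.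
Proof. by rewrite ler_norml sin_geN1 sin_le1. Qed.

Lemma P_sin_gt0 (e a : R) : P (fun x => ((0 < sin (e * (x - a)))%R%:R)%:C).
Proof.
apply: (@P_dominated (fun n x => pos_approx n (sin (e * (x - a)))) _ (fun=> 1)).
- by move=> n; apply: measurable_pos_approx; exact: measurable_sin_affine.
- by move=> x; apply: cvg_pos_approx; exact: sin_le1_norm.
- by move=> n x; apply: pos_approx_bound; exact: sin_le1_norm.
- exact: Rintg_cst.
- by move=> n; apply: P_trigpoly; exact: trigpoly_pos_approx.
Qed.

(** Slow the sine down: once [|x - a| / (k + 1) < pi], the sign of [sin ((x - a) / (k + 1))] is that
    of [x - a], so the periodic indicators converge to that of a half-line. *)
Lemma P_gt (a : R) : P (fun x => ((a < x)%R%:R)%:C).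
Proof.
pose g k x : R := (0 < sin (k.+1%:R^-1 * (x - a)))%R%:R.
apply: (@P_dominated g _ (fun=> 1)).
- move=> k; apply: (@measurable_fun_cvg _ R R setT (fun n (x : R) => pos_approx n (sin (k.+1%:R^-1 * (x - a))))).
    by move=> n; apply: measurable_pos_approx; exact: measurable_sin_affine.
  by move=> x _; apply: cvg_pos_approx; exact: sin_le1_norm.
- move=> x; apply: cvg_near_cst.
  exists (Num.truncn `|x - a|) => // k /= hk.
  have hy : `|k.+1%:R^-1 * (x - a)| < pi.
    rewrite normrM ger0_norm // mulrC ltr_pdivrMr //.
    apply: (@lt_le_trans _ _ k.+1%:R).
      by apply: lt_le_trans (truncnS_gt _) _; rewrite ler_nat.
    by rewrite ler_peMl // (le_trans _ (pi_ge2 R)) // ler1n.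
  rewrite /g; congr ((nat_of_bool _)%:R); move: hy; set y := k.+1%:R^-1 * (x - a) => hy.
  have ya : (0 < y) = (a < x) by rewrite /y pmulr_rgt0 // subr_gt0.
  rewrite -ya; have [y0|y0|<-] := ltgtP 0 y; last by rewrite sin0 ltxx.
    by rewrite sin_gt0_pi // y0; move: hy; rewrite gtr0_norm.
  apply/negbTE; rewrite -leNgt -[y]opprK sinN oppr_le0 ltW //.
  by rewrite sin_gt0_pi // oppr_gt0 y0; move: hy; rewrite ltr0_norm.
- by move=> k x; rewrite /g; case: (0 < _); rewrite ?normr1 ?normr0.
- exact: Rintg_cst.
- by move=> k; exact: P_sin_gt0.
Qed.

(** Dynkin's theorem: open half-lines form a generating pi-system, and the sets with indicator in
    [P] are stable under complements and countable disjoint unions. *)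
Lemma P_indic (S : set R) : measurable S -> P (fun x => (\1_S x)%:C).
Proof.
move=> mS; pose Q (S : set R) := P (fun x => (\1_S x)%:C).
have mE := RGenOInfty.measurableE R.
have : <<s @RGenOInfty.G R >> S.
  have h : (@RGenOInfty.G R).-sigma.-measurable S by rewrite -mE; exact: mS.
  exact: h.
rewrite -/(Q S) => hS; apply: (@dynkin_induction _ R (@RGenOInfty.G R) Q mE _ _ _ _ _ S hS).
- move=> _ _ [a ->] [b ->]; exists (Num.max a b); apply/seteqP; split => x /=.
    by rewrite !in_itv /= !andbT gt_max => -[-> ->].
  by rewrite !in_itv /= !andbT gt_max => /andP.
- rewrite /Q (_ : (fun x => _) = fun=> 1%:C); first exact: P_cst.
  by apply/funext => x; rewrite indicT.
- move=> _ [a ->]; rewrite /Q; have := P_gt a.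
  rewrite (_ : (fun x => ((a < x)%R%:R)%:C) = fun x => (\1_`]a, +oo[ x)%:C) //.
  apply/funext => x; rewrite indicE; congr ((_ : bool)%:R%:C).
  by rewrite mem_setE in_itv /= andbT.
- move=> A mA PA; rewrite /Q.
  have := P_add (P_cst 1) (P_scale (-1) PA).
  rewrite (_ : (fun x => 1 + _) = (fun x => (\1_(~` A) x)%:C)) //.
  apply/funext => x; rewrite !indicE in_setC; case: (x \in A) => /=; rewrite ?rmorph1 ?rmorph0; ring.
- move=> F mF tF PF; rewrite /Q.
  pose A n : set R := \bigcup_(i < n) F i.
  have AS n : (fun x => (\1_(A n.+1) x)%:C) = (fun x => (\1_(A n) x)%:C + (\1_(F n) x)%:C) :> (R -> R[i]).
    apply/funext => x; rewrite -rmorphD /=; congr (_%:C); rewrite !indicE.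
    have -> : (x \in A n.+1) = (x \in A n) || (x \in F n).
      apply/idP/orP => [|]; rewrite !inE.
        move=> [i /=]; rewrite ltnS leq_eqVlt => /predU1P[->|im] Fi; first by right.
        by left; exists i.
      move=> [[i /= im Fi]|Fn]; first by exists i => //=; exact: ltnW.
      by exists n => /=.
    have [xA|] := boolP (x \in A n); last by rewrite add0r.
    have [xF|] := boolP (x \in F n); last by rewrite addr0.
    move: xA xF; rewrite !inE => -[i /= im Fi] Fn.
    by have := tF i n I I (ex_intro _ x (conj Fi Fn)) => E; move: im; rewrite E ltnn.
  apply: (@P_dominated (fun n x => \1_(A n) x) _ (fun=> 1)).
  + by move=> n; apply: measurable_indic; apply: bigcup_measurable => i _; exact: mF.
  + move=> x; apply: cvg_near_cst; rewrite indicE.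
    have [|nx] := boolP (x \in \bigcup_k F k).
      rewrite inE => -[i _ Fi]; exists i.+1 => // n /= ni.
      by rewrite indicE (_ : x \in A n = true) //; apply/mem_set; exists i.
    apply: nearW => n; rewrite indicE; apply/eqP; rewrite pnatr_eq0 eqb0.
    by apply: contra nx; rewrite !inE => -[i _ Fi]; exists i.
  + by move=> n x; rewrite indicE; case: (_ \in _); rewrite ?normr1 ?normr0.
  + exact: Rintg_cst.
  + elim => [|n IH]; last by rewrite AS; exact: (P_add IH (PF n)).
    rewrite (_ : (fun x => _) = (fun=> 0)); first exact: P_cst.
    apply/funext => x; rewrite indicE (_ : x \in A 0%N = false) //.
    by apply/negbTE; rewrite notin_setE => -[j] /=; rewrite ltn0.
Qed.

(** Increasing simple functions approximate [f] and are dominated by [f] itself. *)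
Lemma P_ge0 (f : R -> R) : measurable_fun setT f -> (forall x, 0 <= f x) ->
  Rintg (fun x => f x ^+ 2) -> P (fun x => (f x)%:C).
Proof.
move=> mf f0 fi.
have mf' : measurable_fun setT (EFin \o f) by exact/measurable_EFinP.
pose g := nnsfun_approx measurableT mf'.
have gf x : g k x @[k --> \oo] --> f x.
  have := @cvg_nnsfun_approx _ _ R setT measurableT _ mf' _ x I.
  move=> /(_ (fun y _ => f0 y)) => h; exact: (fine_cvg h).
have g0 k x : 0 <= g k x by exact: fun_ge0.
have gle k x : g k x <= f x.
  have nd : nondecreasing_seq (fun k => g k x).
    by move=> m n mn; have /lefP/(_ x) := nd_nnsfun_approx measurableT mf' mn.
  by have := nondecreasing_cvgn_le nd (cvgP _ (gf x)) k; rewrite (cvg_lim _ (gf x)).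
apply: (@P_dominated (fun k => g k) f f) => //.
  by move=> k x; rewrite ger0_norm.
move=> k.
have -> : (fun x => (g k x)%:C) = (fun x => \sum_(y <- finmap.enum_fset (fset_set (range (g k))))
    y%:C * (\1_(g k @^-1` [set y]) x)%:C) :> (R -> R[i]).
  apply/funext => x; rewrite fimfunE fsbig_finite //= rmorph_sum /=.
  by apply: eq_bigr => y _; rewrite rmorphM.
apply: P_sum => y; apply: P_scale; apply: P_indic.
exact: measurable_sfunP.
Qed.

Lemma P_real (f : R -> R) : measurable_fun setT f ->
  Rintg (fun x => f x ^+ 2) -> P (fun x => (f x)%:C).
Proof.
move=> mf fi.
have pos (g : R -> R) : measurable_fun setT g -> Rintg (fun x => g x ^+ 2) ->
    P (fun x => (Num.max (g x) 0)%:C).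
  move=> mg gi; have mm : measurable_fun setT (fun x => Num.max (g x) 0).
    by apply: measurable_maxr => //; exact: measurable_cst.
  apply: P_ge0 => //; first by move=> x; rewrite le_max lexx orbT.
  apply: Rintg_le gi; first exact: measurable_funX.
  move=> x; rewrite ger0_norm ?sqr_ge0 // maxEle; case: ifP => // _.
  by rewrite expr0n sqr_ge0.
have mNf : measurable_fun setT (fun x => - f x) by exact: measurable_funN.
have Nfi : Rintg (fun x => (- f x) ^+ 2) by under eq_fun do rewrite sqrrN.
have := P_add (pos f mf fi) (P_scale (-1) (pos _ mNf Nfi)).
rewrite (_ : (fun x => _ + _) = (fun x => (f x)%:C)) //.
apply/funext => x; rewrite mulN1r -rmorphB /=; congr (_%:C).
by rewrite !maxEle oppr_le0; have [h1|h1|->] := ltgtP (f x) 0; rewrite ?oppr0; ring.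
Qed.

Lemma trig_dense_L2fun v : L2fun mu v -> P v.
Proof.
move=> hv; have hv' := L2fun_integrable hv; have [mr mi] := L2fun_cmeas hv.
have r2 : Rintg (fun x => complex.Re (v x) ^+ 2).
  apply: Rintg_le hv'; first exact: measurable_funX.
  by move=> x; rewrite ger0_norm ?sqr_ge0 // /sqmod lerDl sqr_ge0.
have i2 : Rintg (fun x => complex.Im (v x) ^+ 2).
  apply: Rintg_le hv'; first exact: measurable_funX.
  by move=> x; rewrite ger0_norm ?sqr_ge0 // /sqmod lerDr sqr_ge0.
have := P_add (P_real mr r2) (P_scale (0 +i* 1) (P_real mi i2)).
rewrite (_ : (fun x => _ + _) = v) //; apply/funext => x.
case: (v x) => a b; apply/eqP; rewrite eq_complex /=.
by apply/andP; split; apply/eqP; ring.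
Qed.

End TrigonometricDensity.

(** * From vanishing limit defects to the Parseval identity *)

Section Parseval.
Variables (R : realType) (mu : probability R R) (Rn : int) (B L : seq int)
  (alpha : int -> R[i]).
Hypotheses (Rn0 : Rn != 0) (uB : uniq B) (uL : uniq L) (L0 : 0 \in L)
  (alpha0 : alpha 0 = 1) (ss : self_similar mu Rn B).
Hypothesis gramE :
  forall c c', c \in B -> c' \in B -> gram Rn L alpha (c - c') = 3 * (c == c')%:R.
Local Notation defect := (defect mu Rn L alpha).
Hypothesis limdef0 : forall t, limdef mu Rn L alpha t = 0.

(** Since [defect n v] decreases in [n] and is nonnegative, one small value for each [e] amounts to
    convergence to 0. *)
Definition vanishing_defect (v : R -> R[i]) :=
  L2fun mu v /\ forall e, 0 < e -> exists n, defect n v < e.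

Let defectD2 n u v : L2fun mu u -> L2fun mu v ->
  defect n (fun x => u x + v x) <= 2 * defect n u + 2 * defect n v.
Proof.
move=> hu hv; have := defectD_le Rn0 uB alpha0 ss gramE n (oner_neq0 R) hu hv.
by rewrite expr1n invr1.
Qed.

(** The density principle with [P := vanishing_defect]; closedness holds because the defect of
    [v - g] is at most its squared norm. *)
Lemma L2fun_vanishing_defect v : L2fun mu v -> vanishing_defect v.
Proof.
apply: trig_dense_L2fun => [t|u {}v [hu du] [hv dv]|c {}v [hv dv]|{}v hv hap].
- split=> [|e e0]; first exact: L2fun_ee.
  have := cvg_limdef Rn0 uB uL L0 alpha0 ss gramE (t := t).
  rewrite limdef0 => /cvgrPdist_lt /(_ e e0) [n _ /(_ n (leqnn n))] /=.
  by rewrite sub0r normrN => h; exists n; apply: le_lt_trans h; exact: ler_norm.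
- split=> [|e e0]; first exact: L2funD.
  have e4 : 0 < e / 4 by rewrite divr_gt0.
  have [n hn] := du _ e4; have [m hm] := dv _ e4; exists (maxn n m).
  have := defectD2 (maxn n m) hu hv.
  have := defect_antitone mu Rn alpha uL L0 u (leq_maxl n m).
  have := defect_antitone mu Rn alpha uL L0 v (leq_maxr n m).
  by lra.
- split=> [|e e0]; first exact: L2funZ.
  have c0 : 0 < sqmod c + 1 by rewrite ltr_wpDl ?sqmod_ge0.
  have [n hn] := dv _ (divr_gt0 e0 c0); exists n; rewrite defectZ //.
  move: hn; rewrite ltr_pdivlMr // => hn; apply: le_lt_trans hn.
  rewrite mulrC ler_wpM2l // ?lerDl //.
  exact: (defect_ge0 Rn0 uB alpha0 ss gramE).
- split=> // e e0; have e4 : 0 < e / 4 by rewrite divr_gt0.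
  have [g [hg dg] ng] := hap _ e4; have [n hn] := dg _ e4; exists n.
  have hvg : L2fun mu (fun x => v x - g x).
    have := L2funD hv (L2funZ (-1) hg).
    by under eq_fun do rewrite mulN1r.
  have := defectD2 n hg hvg.
  rewrite (_ : (fun x => g x + _) = v); last by apply/funext => x; ring.
  have := defect_le_nrm2 mu Rn L alpha n (fun x => v x - g x).
  by lra.
Qed.

Lemma frame_sumE n v : L2fun mu v ->
  \sum_(w <- Omega_le L n) sqmod (cinner mu v (frame_elt Rn alpha w)) =
  nrm2 mu v - defect n v.
Proof.
move=> hv; rewrite /defect subKr; apply: eq_bigr => w _.
exact: sqmod_cinner_frame_elt.
Qed.

(** A finite set of words lies in some [Omega_le L n], so nonnegative defects bound all finite
    partial sums by the squared norm; small defects make the sums over [Omega_le L n] come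
    arbitrarily close to it. *)
Lemma parseval_frame_Omega : parseval_frame mu (Omega L) (frame_elt Rn alpha).
Proof.
move=> v hv; pose F w : R := sqmod (cinner mu v (frame_elt Rn alpha w)).
have -> : (\int[mu]_x (sqmod (v x))%:E = (nrm2 mu v)%:E)%E.
  by rewrite /nrm2 /Rintegral fineK //; apply: integrable_fin_num => //; case: hv => ? [].
have F0 w : 0 <= F w by exact: sqmod_ge0.
apply/eqP; rewrite eq_le; apply/andP; split.
  apply: ub_ereal_sup => _ [X [fX XO] <-].
  rewrite fsbig_finite // sumEFin lee_fin.
  set s := finmap.enum_fset _.
  pose n := \max_(w <- s) size w.
  have sO w : w \in s -> Omega L w.
    by rewrite in_fset_set // => /set_mem; exact: XO.
  have sn : {subset s <= Omega_le L n}.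
    move=> w ws; have := Omega_le_size L0 (sO w ws).
    rewrite !mem_Omega_le // => /andP[-> _] /=.
    by rewrite /n (leq_bigmax_seq (F := size)).
  apply: le_trans (ler_sum_uniq_subset (finmap.fset_uniq _) (uniq_Omega_le uL n) sn F0) _.
  by rewrite frame_sumE // gerBl (defect_ge0 Rn0 uB alpha0 ss gramE).
apply/lee_subgt0Pr => e e0.
have [_ /(_ e e0)[n hn]] := L2fun_vanishing_defect hv.
apply: esum_ge; exists [set` Omega_le L n].
  split; first exact: finite_seq.
  by move=> w /=; exact: Omega_leP.
rewrite -fsbig_seq ?uniq_Omega_le // sumEFin -EFinB lee_fin frame_sumE //.
by rewrite lerB // ltW.
Qed.

End Parseval.

(** * The mask of three digits and condition (v) *)

Section ThreeDigits.
Variables (R : realType) (Rn b1 b2 : int) (L : seq int) (alpha : int -> R[i]).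
Let B := [:: 0; b1; b2].

Lemma mask3E (x : R) : mask B x = 3^-1 * (1 + ee (b1%:~R * x) + ee (b2%:~R * x)).
Proof. by rewrite /mask !big_cons big_nil mul0r ee0 addr0 addrA. Qed.

(** At a zero, [ee (b1 x)] is a nontrivial cube root of unity; the sign of [b1] accounts for the
    absolute value. *)
Lemma mask3_eq0 (x : R) : mask B x = 0 -> (3 * `|b1|)%N%:R * x \is a Num.int.
Proof.
rewrite mask3E => /eqP; rewrite mulf_eq0 invr_eq0 pnatr_eq0 /= => /eqP /ee_sum0.
move=> [k [_ [hk _ _ _ _]]].
have -> : (3 * `|b1|)%N%:R * x = Num.sg b1%:~R * (3 * (b1%:~R * x)) :> R.
  by rewrite natrM natr_absz intr_norm normrEsg; ring.
by rewrite hk rpredM ?intr_int //; case: sgrP => *; rewrite ?rpred0 ?rpred1 ?rpredN1.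
Qed.

Variables (a : nat) (r : int) (beta : nat) (q1 q2 : int) (s : int -> int).
Hypothesis Rn0 : Rn != 0.
Hypothesis conds : conds_i_iv Rn b1 b2 L alpha a r beta q1 q2 s.

(** [q (s l - s l')] is divisible by [r] and by 3, which are coprime, so [b (l - l')] is a multiple
    of [Rn] and the two phases differ by an integer. *)
Lemma mask3_class l l' (t : R) : l \in L -> l != 0 -> l' \in L -> l' != 0 ->
  (s l = s l' %[mod 3])%Z -> mask B (child Rn l t) = mask B (child Rn l' t).
Proof.
move=> lL l0 l'L l'0 ll'.
case: conds => -[a1 [RE r3]] [bt b1E b2E [q13 q23] q12] hs _.
have Rn0' : (Rn%:~R : R) != 0 by rewrite intr_eq0.
have key b q : b = 3 ^+ beta * q -> (r %| q * s l)%Z -> (r %| q * s l')%Z ->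
    ee (b%:~R * child Rn l t) = ee (b%:~R * child Rn l' t).
  move=> bE h1 h2.
  have /dvdzP[k hk] : (r %| q * (s l - s l'))%Z by rewrite mulrBr rpredB.
  have h3 : (3 %| s l - s l')%Z by rewrite -eqz_mod_dvd; apply/eqP.
  have /dvdzP[j hj] : (3 %| k)%Z.
    by apply: contraLR (dvdz_mull q h3) => k3; rewrite hk ndvd3M.
  have hb : b * (l - l') = j * Rn.
    have [lE _ _ _] := hs l lL l0; have [l'E _ _ _] := hs l' l'L l'0.
    rewrite {1}lE {1}l'E bE RE -mulrBr.
    transitivity (3 ^+ (beta + (a - 1 - beta)) * (q * (s l - s l'))); first by rewrite exprD; ring.
    rewrite hk hj [in RHS](_ : a = (1 + (beta + (a - 1 - beta)))%N); last by lia.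
    by rewrite [in RHS]exprD expr1; ring.
  have -> : b%:~R * child Rn l t = b%:~R * child Rn l' t + (- j)%:~R :> R.
    apply: (mulIf Rn0'); rewrite mulrDl rmorphN mulNr -rmorphM /= -hb /child.
    by rewrite rmorphM rmorphB /=; field.
  by rewrite eeD ee_int mulr1.
have [_ _ h1 h2] := hs l lL l0; have [_ _ h1' h2'] := hs l' l'L l'0.
by rewrite !mask3E (key _ _ b1E h1 h1') (key _ _ b2E h2 h2').
Qed.

(** The mask at a child depends only on the class of [s l] mod 3, and condition (v) supplies in each
    class two elements incongruent modulo [Rn]. *)
Lemma mask3_branching : cond_v Rn L s -> forall (t : R) l, l \in L -> l != 0 ->
  mask B (child Rn l t) != 0 ->
  exists l1 l2, [/\ l1 \in L, l2 \in L, mask B (child Rn l1 t) != 0,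
    mask B (child Rn l2 t) != 0 & (l1 != l2 %[mod Rn])%Z].
Proof.
move=> [l1 [l1' [l2 [l2' [[h1 h1' h2 h2'] [n1 n1' n2 n2'] [s1 s1' s2 s2'] [d1 d2]]]]]].
move=> t l lL l0 ml.
have sl : ~~ (3 %| s l)%Z by case: conds => _ _ hs _; have [] := hs l lL l0.
have [e|] := eqVneq (s l %% 3)%Z 1.
  exists l1, l1'; split => //.
    by rewrite (mask3_class t h1 n1 lL l0) // e.
  by rewrite (mask3_class t h1' n1' lL l0) // e.
rewrite ndvd3_modz // => /eqP e; exists l2, l2'; split => //.
  by rewrite (mask3_class t h2 n2 lL l0) // e.
by rewrite (mask3_class t h2' n2' lL l0) // e.
Qed.

End ThreeDigits.

Theorem theorem5p10 (R : realType) (Rn b1 b2 : int) (L : seq int)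
  (alpha : int -> R[i]) (mu : probability R R) :
  (2 <= `|Rn|)%R ->
  uniq [:: 0; b1; b2] ->
  uniq L -> 0 \in L ->
  (forall l, l \in L -> alpha l != 0) -> alpha 0 = 1 ->
  self_similar mu Rn [:: 0; b1; b2] ->
  (orthonormal_columns Rn L [:: 0; b1; b2] alpha <->
     exists a r beta q1 q2 s, conds_i_iv Rn b1 b2 L alpha a r beta q1 q2 s) /\
  (forall a r beta q1 q2 s,
     conds_i_iv Rn b1 b2 L alpha a r beta q1 q2 s -> cond_v Rn L s ->
     parseval_frame mu (Omega L) (frame_elt Rn alpha)).
Proof.
move=> Rn2 uB uL L0 alphaN0 alpha0 ss.
have Rn0 : Rn != 0 by apply: contraTneq Rn2 => ->.
split.
  split=> [|[a [r [beta [q1 [q2 [s]]]]]]]; first exact: orthonormal_columns_conds.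
  exact: conds_orthonormal_columns.
move=> a r beta q1 q2 s conds condv.
have gramE := (orthonormal_columnsP Rn L alpha _).1
  (conds_orthonormal_columns Rn0 uB uL L0 alpha0 conds).
have [b10 _ _] := B_neq0 uB.
have D0 : (0 < 3 * `|b1|)%N by rewrite muln_gt0 absz_gt0.
apply: (parseval_frame_Omega Rn0 uB uL L0 alpha0 ss gramE).
exact: (limdef_eq0 Rn2 uB uL L0 alphaN0 alpha0 ss gramE D0 (@mask3_eq0 R b1 b2)
  (mask3_branching Rn0 conds condv)).
Qed.
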